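(* Let $\alpha\in(0,1)$ and $N\ge 2$. Let $f:[0,\infty)\to\mathbb{R}$ be locally Lipschitz and suppose that there exist $s_0>0$, $\gamma>0$ and $C>0$ such that $$\frac{f(v)-f(u)}{v-u}\le C(u+v)^{\gamma}\qquad\text{for all } 0<u<v<s_0 .$$ Let $u$ be a positive classical solution of $$(-\Delta)^{\alpha}u=f(u)\ \text{ in }\mathbb{R}^N,\qquad u>0\ \text{ in }\mathbb{R}^N,\qquad \lim_{|x|\to\infty}u(x)=0 .$$ Assume further that there exists $$m>\max\left\{\frac{2\alpha}{\gamma},\frac{N}{\gamma+2}\right\}$$ such that $u(x)=O\left(\frac{1}{|x|^m}\right)$ as $|x|\to\infty$. Then $u$ is radially symmetric and strictly decreasing about some point of $\mathbb{R}^N$, i.e. there is $x_0\in\mathbb{R}^N$ such that $u(x)$ depends only on $|x-x_0|$ and is strictly decreasing in $r=|x-x_0|$ for $r>0$.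
   Context: For $\alpha\in(0,1)$ the fractional Laplacian is $$(-\Delta)^\alpha u(x)=P.V.\int_{\mathbb{R}^N}\frac{u(x)-u(y)}{|x-y|^{N+2\alpha}}\,dy,$$ where $P.V.$ denotes the principal value at $y=x$. A classical solution is a continuous function $u:\mathbb{R}^N\to\mathbb{R}$ such that $(-\Delta)^\alpha u(x)$ is defined by this formula at every $x\in\mathbb{R}^N$ and the equation holds pointwise. *)

(* Defs.v *)
From HB Require Import structures.
From mathcomp Require Import all_boot all_order all_algebra.
From mathcomp Require Import all_classical all_reals all_analysis.
Set Implicit Arguments.
Unset Strict Implicit.
Unset Printing Implicit Defensive.
Import Order.TTheory GRing.Theory Num.Theory.
Import numFieldNormedType.Exports.
Local Open Scope classical_set_scope.
Local Open Scope ring_scope.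

(* [`|x|] on ['rV[R]_n] is the sup norm. *)
Definition enorm {R : realType} {n : nat} (x : 'rV[R]_n) : R :=
  Num.sqrt (\sum_(i < n) x ord0 i ^+ 2).

Definition at_infinity {R : realType} {n : nat} : set_system 'rV[R]_n :=
  filter_from setT (fun r : R => [set x | r < enorm x]).

Global Instance at_infinity_filter {R : realType} {n : nat} :
  Filter (@at_infinity R n).
Proof.
apply: filter_from_filter; first by exists 0.
move=> r s _ _; exists (Num.max r s) => // x /=.
by rewrite gt_max => /andP[].
Qed.

(* Lets the Landau notations find the filter structure of [at_infinity]. *)
Canonical at_infinity_filter_on {R : realType} {n : nat} :=
  FilterType (@at_infinity R n) _.

(* The sigma-algebra generated by the coordinates, as for [n.-tuple T]; over
   the reals this is the Borel sigma-algebra of ['rV[R]_n]. *)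
Section measurable_rV.
Context {d : measure_display} {T : measurableType d} (n : nat).

Let coors : 'I_n -> 'rV[T]_n -> T := fun i x => x ord0 i.

Let rV_set0 : g_sigma_preimage coors set0.
Proof. exact: sigma_algebra0. Qed.

Let rV_setC A : g_sigma_preimage coors A -> g_sigma_preimage coors (~` A).
Proof. exact: sigma_algebraC. Qed.

Let rV_bigcup (F : (set 'rV[T]_n)^nat) :
  (forall i, g_sigma_preimage coors (F i)) ->
  g_sigma_preimage coors (\bigcup_i (F i)).
Proof. exact: sigma_algebra_bigcup. Qed.

HB.instance Definition _ := @isMeasurable.Build (measure_tuple_display d)
  'rV[T]_n (g_sigma_preimage coors) rV_set0 rV_setC rV_bigcup.

End measurable_rV.

Lemma measurable_coord d (T : measurableType d) n (i : 'I_n) :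
  measurable_fun [set: 'rV[T]_n] (fun x : 'rV[T]_n => x ord0 i).
Proof.
move=> _ Y mY; rewrite setTI; apply: sub_sigma_algebra => /=.
rewrite -bigcup_seq/=; exists i => /=; first by rewrite mem_index_enum.
by exists Y => //; rewrite setTI.
Qed.

Lemma measurable_fun_coordP d1 d2 (T1 : measurableType d1)
    (T2 : measurableType d2) n (f : T1 -> 'rV[T2]_n) :
  measurable_fun [set: T1] f <->
  forall i, measurable_fun [set: T1] (fun x => f x ord0 i).
Proof.
split=> [mf i|mf].
  apply: (@measurableT_comp _ _ _ _ _ _ (fun v : 'rV[T2]_n => v ord0 i)) => //.
  exact: measurable_coord.
suff H : @measurable _ 'rV[T2]_n `<=` [set A | measurable (f @^-1` A)].
  by move=> _ A mA; rewrite setTI; exact: H.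
apply: smallest_sub.
  split => /=; first by rewrite preimage_set0.
  - by move=> A mA; rewrite setTD preimage_setC; exact: measurableC.
  - by move=> F mF; rewrite preimage_bigcup; exact: bigcup_measurable.
rewrite -bigcup_seq => A [i _ [B mB <-]] /=.
rewrite !setTI; have := mf i measurableT B mB; by rewrite setTI.
Qed.

(* ['rV_0] is a point, of measure 1; ['rV_n.+1] is R x ['rV_n]. *)
Fixpoint lebesgue_rV {R : realType} (n : nat) : set 'rV[R]_n -> \bar R :=
  match n return set 'rV[R]_n -> \bar R with
  | 0 => dirac (0 : 'rV[R]_0)
  | n'.+1 => pushforward (@lebesgue_measure R \x lebesgue_rV (n := n'))%E
      (fun p : R * 'rV[R]_n' => row_mx p.1%:M p.2 : 'rV[R]_n'.+1)
  end.
Arguments lebesgue_rV {R} n _.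

Section lebesgue_rV_measure.
Local Open Scope ereal_scope.
Context {R : realType}.

Let cons n (p : R * 'rV[R]_n) : 'rV[R]_n.+1 := row_mx p.1%:M p.2.
Let uncons n (v : 'rV[R]_n.+1) : R * 'rV[R]_n :=
  (v ord0 ord0, \row_j v ord0 (lift ord0 j)).

Let consE0 n (p : R * 'rV[R]_n) : cons p ord0 ord0 = p.1.
Proof.
have -> : ord0 = lshift n (ord0 : 'I_1) :> 'I_n.+1 by exact/val_inj.
by rewrite /cons (@row_mxEl _ 1 1 n) mxE eqxx mulr1n.
Qed.

Let consES n (p : R * 'rV[R]_n) (j : 'I_n) :
  cons p ord0 (lift ord0 j) = p.2 ord0 j.
Proof.
have -> : lift ord0 j = rshift 1 j :> 'I_n.+1 by exact/val_inj.
by rewrite /cons (@row_mxEr _ 1 1 n).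
Qed.

Let consK n : cancel (@cons n) (@uncons n).
Proof.
move=> [a v]; rewrite /uncons consE0; congr pair.
by apply/rowP => j; rewrite mxE consES.
Qed.

Let unconsK n : cancel (@uncons n) (@cons n).
Proof.
move=> v; apply/rowP => i; have [j ->|->] := unliftP ord0 i.
  by rewrite consES mxE.
by rewrite consE0.
Qed.

Let measurable_cons_rV n : measurable_fun [set: R * 'rV[R]_n] (@cons n).
Proof.
apply/measurable_fun_coordP => i; have [j ->|->] := unliftP ord0 i.
  rewrite (_ : (fun _ => _) = (fun v : 'rV[R]_n => v ord0 j) \o snd).
    by apply: measurableT_comp => //; exact: measurable_coord.
  by apply/funext => p; rewrite /= consES.
rewrite (_ : (fun _ => _) = fst); first exact: measurable_fst.
by apply/funext => p; rewrite /= consE0.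
Qed.

Let measurable_uncons_rV n : measurable_fun [set: 'rV[R]_n.+1] (@uncons n).
Proof.
apply/measurable_fun_pairP; split; first exact: measurable_coord.
apply/measurable_fun_coordP => j.
rewrite (_ : (fun _ => _) = (fun v : 'rV[R]_n.+1 => v ord0 (lift ord0 j))).
  exact: measurable_coord.
by apply/funext => v; rewrite /= mxE.
Qed.

Let lebesgue_rVP n : exists mu : {sigma_finite_measure set 'rV[R]_n -> \bar R},
  lebesgue_rV n = mu.
Proof.
elim: n => [|n [mu muE]].
  by exists (dirac (0%R : 'rV[R]_0)).
pose pi : {measure set (measurableTypeR R * 'rV[R]_n)%type -> \bar R} :=
  (@lebesgue_measure R \x mu).
have mc := @measurable_cons_rV n.
pose nu : {measure set 'rV[R]_n.+1 -> \bar R} :=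
  measure_function_pushforward__canonical__measure_function_Measure pi mc.
have nuE : lebesgue_rV n.+1 = nu by rewrite /= muE.
have sf : sigma_finite setT nu.
  have [F FT Foo] : sigma_finite setT pi.
    have /sigma_finiteP[F [TF ndF Foo]] := sigma_finiteT (@lebesgue_measure R).
    have /sigma_finiteP[G [TG ndG Goo]] := sigma_finiteT mu.
    exists (fun k => F k `*` G k).
      rewrite -setXTT TF TG; apply/seteqP; split => -[x y].
        move=> [/= [k _ Fkx] [l _ Gly]]; exists (maxn k l) => //; split.
        - by move: x Fkx; exact/subsetPset/ndF/leq_maxl.
        - by move: y Gly; exact/subsetPset/ndG/leq_maxr.
      by move=> [k _ []/= ? ?]; split; exists k.
    move=> k; have [mFk Fk] := Foo k; have [mGk Gk] := Goo k.
    split; first exact: measurableX.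
    by rewrite /pi/= product_measure1E// lte_mul_pinfty// ge0_fin_numE.
  exists (fun k => @uncons n @^-1` F k).
    by rewrite -preimage_bigcup -FT preimage_setT.
  move=> k; have [mF Fk] := Foo k; split.
    by rewrite -[X in measurable X]setTI; exact: measurable_uncons_rV.
  rewrite /nu/= /pushforward -comp_preimage.
  by rewrite (_ : _ \o _ = id)//; apply/funext => p; exact: consK.
pose H := Measure_isSigmaFinite.Build _ _ _ (Measure.sort nu) sf.
pose mu' : {sigma_finite_measure set 'rV[R]_n.+1 -> \bar R} :=
  HB.pack_for (SigmaFiniteMeasure.type 'rV[R]_n.+1 R) (Measure.sort nu) H.
by exists mu'.
Qed.

Let lebesgue_rV0 n : @lebesgue_rV R n set0 = 0.
Proof. by have [mu ->] := lebesgue_rVP n; exact: measure0. Qed.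

Let lebesgue_rV_ge0 n A : 0 <= @lebesgue_rV R n A.
Proof. by have [mu ->] := lebesgue_rVP n; exact: measure_ge0. Qed.

Let lebesgue_rV_sigma_additive n : semi_sigma_additive (@lebesgue_rV R n).
Proof.
by have [mu ->] := lebesgue_rVP n; exact: measure_semi_sigma_additive.
Qed.

HB.instance Definition _ n := isMeasure.Build _ _ _ (@lebesgue_rV R n)
  (lebesgue_rV0 n) (@lebesgue_rV_ge0 n) (@lebesgue_rV_sigma_additive n).

Let lebesgue_rV_sigma_finite n : sigma_finite setT (@lebesgue_rV R n).
Proof. by have [mu ->] := lebesgue_rVP n; exact: sigma_finiteT. Qed.

HB.instance Definition _ n := Measure_isSigmaFinite.Build _ _ _
  (@lebesgue_rV R n) (@lebesgue_rV_sigma_finite n).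

Lemma lebesgue_rV_setX n (A : 'I_n -> set R) :
  (forall i, measurable (A i)) ->
  lebesgue_rV n [set v | forall i, A i (v ord0 i)] =
  \prod_(i < n) lebesgue_measure (A i).
Proof.
elim: n A => [|n IH] A mA.
  rewrite big_ord0 /= diracE mem_set//= => i; by case: i.
rewrite big_ord_recl -IH => [|i]; last exact: mA.
pose B' := [set v : 'rV[R]_n | forall i, A (lift ord0 i) (v ord0 i)].
rewrite -/B'.
have mB' : measurable B'.
  rewrite (_ : B' = \bigcap_(i in [set: 'I_n])
      ((fun v : 'rV[R]_n => v ord0 i) @^-1` A (lift ord0 i))).
    apply: fin_bigcap_measurable => // i _.
    by rewrite -[X in measurable X]setTI; exact: measurable_coord.
  by apply/seteqP; split => v /= Av i => [_|]; exact: Av.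
rewrite -product_measure1E//; last exact: mA.
rewrite /= /pushforward; congr (_ _).
apply/seteqP; split => p /=.
  move=> Ap; split => [|i]; first by have := Ap ord0; rewrite consE0.
  by have := Ap (lift ord0 i); rewrite consES.
move=> [A0 AS] i; have [j ->|->] := unliftP ord0 i.
  by rewrite consES; exact: AS.
by rewrite consE0.
Qed.

End lebesgue_rV_measure.

Section fractional_laplacian.
Context {R : realType} {N : nat} (alpha : R) (u : 'rV[R]_N -> R).

Definition fracLap_integrand (x y : 'rV[R]_N) : R :=
  (u x - u y) / enorm (x - y) `^ (N%:R + 2 * alpha).

Definition fracLap_trunc (x : 'rV[R]_N) (e : R) : R :=
  \int[@lebesgue_rV R N]_(y in [set y | e <= enorm (x - y)])
    fracLap_integrand x y.

(* The principal value is only at [y = x]: away from [x] the integral is an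
   absolutely convergent Lebesgue integral.  The formula carries no
   normalization constant. *)
Definition fracLap_defined (x : 'rV[R]_N) : Prop :=
  (forall e : R, 0 < e ->
     (@lebesgue_rV R N).-integrable [set y | e <= enorm (x - y)]
       (EFin \o fracLap_integrand x)) /\
  cvg (fracLap_trunc x e @[e --> 0^'+]).

Definition fracLap (x : 'rV[R]_N) : R := lim (fracLap_trunc x e @[e --> 0^'+]).

End fractional_laplacian.

Definition classical_solution {R : realType} {N : nat} (alpha : R) (f : R -> R)
    (u : 'rV[R]_N -> R) : Prop :=
  continuous u /\
  forall x, fracLap_defined alpha u x /\ fracLap alpha u x = f (u x).

Definition radially_symmetric_decreasing {R : realType} {N : nat}
    (u : 'rV[R]_N -> R) (x0 : 'rV[R]_N) : Prop :=
  exists phi : R -> R,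
    (forall x, u x = phi (enorm (x - x0))) /\
    (forall r s : R, 0 < r -> r < s -> phi s < phi r).

(* Main.v *)
Require Import Defs.
From mathcomp Require Import all_boot all_order all_algebra.
From mathcomp Require Import all_classical all_reals all_analysis.
From mathcomp Require Import measurable_realfun.
From mathcomp Require Import ring lra.
Set Implicit Arguments.
Unset Strict Implicit.
Unset Printing Implicit Defensive.
Import Order.TTheory GRing.Theory Num.Theory.
Import numFieldNormedType.Exports.
Local Open Scope classical_set_scope.
Local Open Scope ring_scope.

(** The theorem is proved by moving planes, driven by a maximum principle that
is read off the integral formula at a single point.

For a unit vector [e] and a real [l], let sigma be the reflection across the
hyperplane x.e = l and let w = u o sigma - u.  Write p = N + 2 alpha.  The
substitution y -> sigma y turns the fractional Laplacian of u at sigma x minus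
the one at x into the principal value of

  (w x - w y) / |x - y|^p

over y.  Averaging this integrand over y and sigma y, and using
w (sigma y) = - w y, leaves on the half-space y.e > l the kernel

  (w x - w y) / |x - y|^p + (w x + w y) / |x - sigma y|^p.

If x lies in the half-space and w attains there its minimum at x, then the
first numerator is nonpositive; as x is closer to y than to sigma y, the sum is
at most 2 w x / |x - sigma y|^p.  Integrating this over a well-placed cube gives
two facts: if w x < 0 and x is at distance d from the hyperplane, the difference
is at most c w x d^(-2 alpha) with c > 0 ([fracLap_narrow]); if w x = 0 and w is
positive somewhere, the difference is negative ([fracLap_strict]).

The equation equates the difference with f (u (sigma x)) - f (u x).  So at a
negative minimum x the difference quotient of f between u (sigma x) and u x is
at least c d^(-2 alpha).  On the range of u this quotient is bounded, since f is
Lipschitz there, so d is bounded below ([negative_minimum_far]).  Far away, the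
growth condition bounds it by a constant times |x|^(-m gamma) while d <= 2 |x|;
as m gamma > 2 alpha, |x| is bounded ([negative_minimum_bounded]).  Negative
minima therefore stay in a compact subset of the open half-space.

Moving the hyperplane in from infinity, one keeps w >= 0 until some l0.  There
w > 0 throughout the half-space is impossible: by compactness w >= 0 would
persist a little further.  By the strict principle w = 0, so the hyperplane
x.e = l0 is a symmetry of u, and u decreases strictly beyond it
([moving_planes_stop]).  A maximum point x0 of u must lie on this hyperplane,
for every direction e ([symmetric_at_maximum]).  Hence u is invariant under all
reflections through x0, which makes it radial about x0.

The averaging step needs the Lebesgue measure of row vectors, built as an
iterated product, to be invariant under reflections; this follows from
translation invariance by a Fubini argument ([lebesgue_rV_swap]). *)

(** * Euclidean geometry and hyperplane reflections *)

Section euclidean.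
Context {R : realType} {n : nat}.
Implicit Types x y z e : 'rV[R]_n.

Definition dot x y : R := \sum_(i < n) x ord0 i * y ord0 i.

Lemma dotC x y : dot x y = dot y x.
Proof. by apply: eq_bigr => i _; rewrite mulrC. Qed.

Lemma dotDl x y z : dot (x + y) z = dot x z + dot y z.
Proof. by rewrite -big_split; apply: eq_bigr => i _; rewrite mxE mulrDl. Qed.

Lemma dotZl (a : R) x y : dot (a *: x) y = a * dot x y.
Proof. by rewrite /dot mulr_sumr; apply: eq_bigr => i _; rewrite mxE mulrA. Qed.

Lemma dotNl x y : dot (- x) y = - dot x y.
Proof. by rewrite -scaleN1r dotZl mulN1r. Qed.

Lemma dot0l x : dot 0 x = 0.
Proof. by apply: big1 => i _; rewrite mxE mul0r. Qed.

Lemma dotDr x y z : dot x (y + z) = dot x y + dot x z.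
Proof. by rewrite dotC dotDl !(dotC _ x). Qed.

Lemma dotZr (a : R) x y : dot x (a *: y) = a * dot x y.
Proof. by rewrite dotC dotZl dotC. Qed.

Lemma dotNr x y : dot x (- y) = - dot x y.
Proof. by rewrite dotC dotNl dotC. Qed.

Definition dotE := (dotDl, dotDr, dotZl, dotZr, dotNl, dotNr).

Lemma dot_ge0 x : 0 <= dot x x.
Proof. by apply: sumr_ge0 => i _; rewrite -expr2 sqr_ge0. Qed.

Lemma enormE x : enorm x = Num.sqrt (dot x x).
Proof. by congr Num.sqrt; apply: eq_bigr => i _; rewrite expr2. Qed.

Lemma enorm_ge0 x : 0 <= enorm x.
Proof. exact: sqrtr_ge0. Qed.

Lemma sqr_enorm x : enorm x ^+ 2 = dot x x.
Proof. by rewrite enormE sqr_sqrtr ?dot_ge0. Qed.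

Lemma dot_eq0 x : (dot x x == 0) = (x == 0).
Proof.
apply/eqP/eqP => [/eqP|->]; last exact: dot0l.
rewrite psumr_eq0 => [/allP x0|i _]; last by rewrite -expr2 sqr_ge0.
apply/rowP => i; rewrite mxE; have := x0 i (mem_index_enum i).
by rewrite -expr2 sqrf_eq0 => /eqP.
Qed.

Lemma enorm_eq0 x : (enorm x == 0) = (x == 0).
Proof. by rewrite -dot_eq0 -sqr_enorm sqrf_eq0. Qed.

Lemma enorm0 : enorm (0 : 'rV[R]_n) = 0.
Proof. by apply/eqP; rewrite enorm_eq0. Qed.

Lemma enorm_gt0 x : x != 0 -> 0 < enorm x.
Proof. by rewrite lt_def enorm_ge0 andbT enorm_eq0. Qed.

Lemma enormZ (a : R) x : enorm (a *: x) = `|a| * enorm x.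
Proof.
rewrite !enormE dotZl dotZr mulrA -expr2 sqrtrM ?sqr_ge0//.
by rewrite sqrtr_sqr.
Qed.

Lemma enormN x : enorm (- x) = enorm x.
Proof. by rewrite -scaleN1r enormZ normrN1 mul1r. Qed.

Lemma enormB x y : enorm (x - y) = enorm (y - x).
Proof. by rewrite -enormN opprB. Qed.

Lemma dot_le_enorm x y : dot x y <= enorm x * enorm y.
Proof.
have [->|y0] := eqVneq y 0.
  by rewrite enorm0 mulr0 dotC dot0l.
have py := enorm_gt0 y0.
have [->|x0] := eqVneq x 0.
  by rewrite enorm0 mul0r dot0l.
have px := enorm_gt0 x0.
(* the square of |y| x - |x| y is 2 |x| |y| (|x| |y| - x.y) *)
have := dot_ge0 (enorm y *: x - enorm x *: y).
rewrite !dotE -!sqr_enorm (dotC y x) => h.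
rewrite -(ler_pM2l (mulr_gt0 px py)); nra.
Qed.

Lemma enorm_unit e : dot e e = 1 -> enorm e = 1.
Proof. by move=> e1; rewrite enormE e1 sqrtr1. Qed.

Lemma dot_unit_le e x : dot e e = 1 -> dot x e <= enorm x.
Proof. by move=> /enorm_unit e1; rewrite (le_trans (dot_le_enorm _ _))// e1 mulr1. Qed.

Lemma enormD x y : enorm (x + y) <= enorm x + enorm y.
Proof.
rewrite -(@ler_pXn2r _ 2) ?nnegrE ?addr_ge0 ?enorm_ge0//.
rewrite sqr_enorm !dotE -!sqr_enorm (dotC y x).
have := dot_le_enorm x y; nra.
Qed.

Lemma enorm_distD z x y : enorm (x - y) <= enorm (x - z) + enorm (z - y).
Proof. by rewrite (le_trans _ (enormD _ _))// addrA subrK. Qed.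

Lemma coord_le_enorm x i : `|x ord0 i| <= enorm x.
Proof.
rewrite -sqrtr_sqr enormE ler_sqrt ?dot_ge0// /dot (bigD1 i)//= expr2 lerDl.
by apply: sumr_ge0 => j _; rewrite -expr2 sqr_ge0.
Qed.

Lemma enorm_le_coord x (r : R) : (forall i, `|x ord0 i| <= r) -> 0 <= r ->
  enorm x <= n%:R * r.
Proof.
move=> xr r0; have nr0 : 0 <= n%:R * r by rewrite mulr_ge0.
rewrite -(@ler_pXn2r _ 2) ?nnegrE ?enorm_ge0// sqr_enorm.
apply: (@le_trans _ _ (\sum_(i < n) r ^+ 2)).
  apply: ler_sum => i _; rewrite -expr2 -real_normK ?num_real//.
  by rewrite ler_pXn2r ?nnegrE.
rewrite sumr_const card_ord -[leLHS]mulr_natl exprMn; apply: ler_wpM2r; rewrite ?sqr_ge0//.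
by rewrite -natrX ler_nat; case: (n) => // k; rewrite leq_pmulr.
Qed.

Lemma continuous_dotl y : continuous (fun x : 'rV[R]_n => dot x y).
Proof.
apply: continuous_big => [|i _ x]; first exact: add_continuous.
by apply: (@cvgMr_tmp R _ (nbhs x)); exact: coord_continuous.
Qed.

Lemma continuous_enorm : continuous (@enorm R n).
Proof.
have cdot : continuous (fun x : 'rV[R]_n => dot x x).
  apply: continuous_big => [|i _ x]; first exact: add_continuous.
  by apply: (@cvgM R _ (nbhs x)); exact: coord_continuous.
rewrite (_ : @enorm R n = Num.sqrt \o (fun x => dot x x)); last first.
  by apply/funext => x; exact: enormE.
by move=> x; apply: continuous_comp; [exact: cdot|exact: sqrt_continuous].
Qed.

Lemma measurable_dotl y : measurable_fun [set: 'rV[R]_n] (dot^~ y).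
Proof.
apply: measurable_sum => i.
by apply: measurable_funM => //; exact: measurable_coord.
Qed.

Lemma measurable_enorm : measurable_fun [set: 'rV[R]_n] (@enorm R n).
Proof.
apply: (@measurableT_comp _ _ _ _ _ _ (Num.sqrt : R -> R)).
  by apply: continuous_measurable_fun => x; exact: sqrt_continuous.
apply: measurable_sum => i.
by apply: measurable_funX; exact: measurable_coord.
Qed.

(** For a unit vector [e], the reflection across the hyperplane x.e = l. *)
Definition refl e (l : R) x : 'rV[R]_n := x - (2 * (dot x e - l)) *: e.

Lemma dot_refl e l x : dot e e = 1 -> dot (refl e l x) e = 2 * l - dot x e.
Proof. by move=> e1; rewrite /refl !dotE e1; ring. Qed.

Lemma reflK e l x : dot e e = 1 -> refl e l (refl e l x) = x.
Proof.
move=> e1; rewrite {1}/refl dot_refl// /refl -addrA -opprD -scalerDl.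
have -> : 2 * (dot x e - l) + 2 * (2 * l - dot x e - l) = 0 by ring.
by rewrite scale0r subr0.
Qed.

Lemma enorm_refl_sub e l x y : dot e e = 1 ->
  enorm (refl e l x - refl e l y) = enorm (x - y).
Proof.
move=> e1; rewrite !enormE /refl !dotE e1 (dotC _ e); congr Num.sqrt.
by rewrite (dotC y e); ring.
Qed.

(** Gives at once how much farther from [x] a point gets when it is reflected
to the other side of the hyperplane. *)
Lemma sqr_enorm_sub_refl e l x y : dot e e = 1 ->
  enorm (x - refl e l y) ^+ 2 =
  enorm (x - y) ^+ 2 + 4 * (dot x e - l) * (dot y e - l).
Proof. by move=> e1; rewrite !sqr_enorm /refl !dotE e1 !(dotC e) (dotC y x); ring. Qed.

Lemma le_enorm_sub_refl e l x y : dot e e = 1 ->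
  l <= dot x e -> l <= dot y e -> enorm (x - y) <= enorm (x - refl e l y).
Proof.
move=> e1 lx ly; have := sqr_enorm_sub_refl l x y e1.
have : 0 <= (dot x e - l) * (dot y e - l) by rewrite mulr_ge0 ?subr_ge0.
move=> h1 h2; rewrite -(@ler_pXn2r _ 2) ?nnegrE ?enorm_ge0// h2.
by rewrite -mulrA lerDl mulr_ge0.
Qed.

Lemma lt_enorm_sub_refl e l x y : dot e e = 1 ->
  l < dot x e -> l < dot y e -> enorm (x - y) < enorm (x - refl e l y).
Proof.
move=> e1 lx ly; have := sqr_enorm_sub_refl l x y e1.
have : 0 < (dot x e - l) * (dot y e - l) by rewrite mulr_gt0 ?subr_gt0.
move=> h1 h2; rewrite -(@ltr_pXn2r _ 2) ?nnegrE ?enorm_ge0// h2.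
by rewrite -mulrA ltrDl mulr_gt0.
Qed.

Lemma continuous_refl e l : continuous (refl e l).
Proof.
move=> x; apply: (@cvgB R _ _ (nbhs x)); first exact: cvg_id.
apply: (@cvgZr_tmp R _ _ (nbhs x)); apply: (@cvgMl_tmp R _ (nbhs x)).
by apply: (@cvgB R _ _ (nbhs x)); [exact: continuous_dotl|exact: cvg_cst].
Qed.

Lemma measurable_refl e l : measurable_fun [set: 'rV[R]_n] (refl e l).
Proof.
apply/measurable_fun_coordP => i.
rewrite (_ : (fun _ => _) =
  (fun x : 'rV[R]_n => x ord0 i - 2 * (dot x e - l) * e ord0 i)); last first.
  by apply/funext => x; rewrite !mxE.
apply: measurable_funB; first exact: measurable_coord.
apply: measurable_funM => //; apply: measurable_funM => //.
by apply: measurable_funB => //; exact: measurable_dotl.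
Qed.

End euclidean.

(** * Translation invariance of the Lebesgue measure *)

Section lebesgue_rV_translation.
Local Open Scope ereal_scope.
Context {R : realType}.

Lemma lebesgue_measure_shift (t : R) (A : set R) : measurable A ->
  lebesgue_measure ((fun x => x + t)%R @^-1` A) = lebesgue_measure A.
Proof.
move=> mA.
have mt : measurable_fun [set: measurableTypeR R]
    ((fun x => x + t)%R : measurableTypeR R -> measurableTypeR R).
  by apply: measurable_funD.
pose nu : {measure set (measurableTypeR R) -> \bar R} :=
  measure_function_pushforward__canonical__measure_function_Measure
    (@lebesgue_measure R) mt.
suff : lebesgue_measure A = nu A by [].
apply: lebesgue_measure_unique => //= _ [[a b]] _ <-.
rewrite /nu /= /pushforward.
have -> : (fun x => x + t)%R @^-1` [set` `]a, b]] =
    [set` `](a - t)%R, (b - t)%R]].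
  by apply/seteqP; split => x /=; rewrite !in_itv/= ltrBlDr lerBrDr.
rewrite !lebesgue_measure_itv/= !lte_fin ltrD2r -!EFinD.
by rewrite [in RHS]opprB addrA addrNK.
Qed.

Definition box {n} (A : 'I_n -> set R) : set 'rV[R]_n :=
  [set v | forall i, A i (v ord0 i)].

Lemma measurable_box n (A : 'I_n -> set R) :
  (forall i, measurable (A i)) -> measurable (box A).
Proof.
move=> mA.
have -> : box A = \bigcap_(i in [set: 'I_n])
    ((fun v : 'rV[R]_n => v ord0 i) @^-1` A i).
  by apply/seteqP; split => v /= Av i => [_|]; exact: Av.
apply: fin_bigcap_measurable => // i _.
by rewrite -[X in measurable X]setTI; exact: measurable_coord.
Qed.

Let boxes n : set (set 'rV[R]_n) :=
  [set B | exists2 A : 'I_n -> set R, (forall i, measurable (A i)) & B = box A].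

Let boxesE n : @measurable _ 'rV[R]_n = <<s @boxes n >>.
Proof.
apply/seteqP; split.
  apply: smallest_sub; first exact: smallest_sigma_algebra.
  rewrite -bigcup_seq => _ [i _ [B mB <-]] /=; rewrite setTI.
  apply: sub_sigma_algebra.
  exists (fun j => if j == i then B else setT).
    by move=> j; case: ifP.
  apply/seteqP; split => v /=; last by move=> /(_ i); rewrite eqxx.
  by move=> Bv j; case: eqP => // ->.
apply: smallest_sub; first exact: sigma_algebra_measurable.
by move=> _ [A mA ->]; exact: measurable_box.
Qed.

Lemma lebesgue_rV_itv_box n (a b : 'I_n -> R) : (forall i, a i <= b i)%R ->
  @lebesgue_rV R n (box (fun i => [set` `[a i, b i]%R])) =
  (\prod_(i < n) (b i - a i)%R)%:E.
Proof.
move=> ab; rewrite lebesgue_rV_setX// (big_morph _ (@EFinM R) erefl).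
apply: eq_bigr => i _; rewrite lebesgue_measure_itv/= lte_fin.
have := ab i; rewrite le_eqVlt => /predU1P[->|->]; last by rewrite -EFinD.
by rewrite ltxx subrr.
Qed.

Lemma measurable_shift_rV n (t : 'rV[R]_n) :
  measurable_fun [set: 'rV[R]_n] (fun x => x + t)%R.
Proof.
apply/measurable_fun_coordP => i.
rewrite (_ : (fun _ => _) = (fun x : 'rV[R]_n => x ord0 i + t ord0 i)%R).
  by apply: measurable_funD => //; exact: measurable_coord.
by apply/funext => x; rewrite mxE.
Qed.

(** Boxes with measurable sides are stable under intersection, generate the
sigma-algebra, and have translation-invariant measure by the one-dimensional
case. *)
Lemma lebesgue_rV_shift n (t : 'rV[R]_n) A : measurable A ->
  @lebesgue_rV R n ((fun x => x + t)%R @^-1` A) = lebesgue_rV n A.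
Proof.
move=> mA; have mt := measurable_shift_rV t.
pose nu : {measure set 'rV[R]_n -> \bar R} :=
  measure_function_pushforward__canonical__measure_function_Measure
    (@lebesgue_rV R n) mt.
suff : lebesgue_rV n A = nu A by [].
apply: (measure_unique (@boxes n)
  (fun k => box (fun=> [set` `[- k%:R, k%:R]%R]))) => //=.
- exact: boxesE.
- move=> _ _ [A1 mA1 ->] [A2 mA2 ->]; exists (fun i => A1 i `&` A2 i).
    by move=> i; exact: measurableI.
  apply/seteqP; split => v /= => [[v1 v2] i|v12]; first by split.
  by split => i; have [] := v12 i.
- by move=> k; exists (fun=> [set` `[- k%:R, k%:R]%R]).
- apply/seteqP; split => // v _.
  exists (Num.truncn (enorm v)).+1 => //= i; rewrite /= in_itv/= -ler_norml.
  rewrite (le_trans (coord_le_enorm _ _))// ltW//.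
  by rewrite truncnS_gt.
- move=> _ [B mB ->]; rewrite /nu/= /pushforward.
  have -> : (fun x => x + t)%R @^-1` box B =
      box (fun i => (fun x => x + t ord0 i)%R @^-1` B i).
    by apply/seteqP; split => v /= Bv i; have := Bv i; rewrite mxE.
  rewrite !lebesgue_rV_setX//.
    by apply: eq_bigr => i _; rewrite lebesgue_measure_shift.
  move=> i; rewrite -[X in measurable X]setTI.
  by apply: measurable_funD.
- move=> k; rewrite lebesgue_rV_itv_box ?ltry// => _.
  by rewrite (le_trans (y := 0)%R) ?oppr_le0.
Qed.

End lebesgue_rV_translation.

(** * Cubes and Euclidean neighborhoods *)

Section enorm_neighborhoods.
Context {R : realType} {n : nat}.
Implicit Types x y : 'rV[R]_n.

(** The topology of row vectors comes from the sup norm, which is at most the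
Euclidean norm. *)
Lemma nbhs_enormP x (P : set 'rV[R]_n) : nbhs x P ->
  exists2 d : R, 0 < d & forall y, enorm (x - y) < d -> P y.
Proof.
move=> /nbhs_ballP[d /= d0 dP]; exists d => // y xy; apply: dP.
split=> // i j; rewrite (ord1 i).
have := coord_le_enorm (x - y) j; rewrite !mxE => h; exact: le_lt_trans h xy.
Qed.

Lemma powR_continuous (q a : R) : 0 < a -> {for a, continuous (@powR R ^~ q)}.
Proof.
move=> a0; apply: differentiable_continuous; apply/derivable1_diffP.
by apply: derivable_powR; rewrite in_itv/= a0.
Qed.

Definition cube x (r : R) : set 'rV[R]_n :=
  box (fun i => [set` `[x ord0 i - r, x ord0 i + r]%R]).

Lemma measurable_cube x r : measurable (cube x r).
Proof. by apply: measurable_box => i. Qed.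

Lemma lebesgue_cube x r : 0 <= r ->
  lebesgue_rV n (cube x r) = ((2 * r) ^+ n)%:E.
Proof.
move=> r0; rewrite lebesgue_rV_itv_box => [|i]; last by rewrite lerD2l ge0_cp.
congr EFin; rewrite (eq_bigr (fun=> 2 * r)) ?prodr_const ?card_ord// => i _.
by ring.
Qed.

Lemma enorm_cube x r y : 0 <= r -> cube x r y -> enorm (x - y) <= n%:R * r.
Proof.
move=> r0 xy; apply: enorm_le_coord => // i.
have := xy i; rewrite /= in_itv/= !mxE => /andP[? ?].
by rewrite ler_distlC; apply/andP.
Qed.

End enorm_neighborhoods.

(** * Invariance of the Lebesgue measure under linear isometries *)

Section lebesgue_rV_isometry.
Local Open Scope ereal_scope.
Context {R : realType} {n : nat}.
Notation mu := (@lebesgue_rV R n).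

Lemma measurable_unit_ball : measurable [set v : 'rV[R]_n | (enorm v <= 1)%R].
Proof.
rewrite -[X in measurable X]setTI.
rewrite (_ : [set v | _] = @enorm R n @^-1` [set` `]-oo, 1%R]]); last first.
  by apply/seteqP; split => v /=; rewrite in_itv.
by apply: measurable_enorm.
Qed.

Lemma lebesgue_unit_ball_gt0_lty :
  0 < mu [set v : 'rV[R]_n | (enorm v <= 1)%R] < +oo.
Proof.
have mB := measurable_unit_ball.
have n1 : (0 < n.+1%:R^-1 :> R)%R by rewrite invr_gt0.
apply/andP; split.
  apply: (@lt_le_trans _ _
    (mu (box (fun=> [set` `[- n.+1%:R^-1, n.+1%:R^-1]%R])))).
    rewrite lebesgue_rV_itv_box => [|i]; last by case: (ge0_cp (ltW n1)).
    by rewrite lte_fin prodr_gt0// => i _; rewrite opprK addr_gt0.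
  apply: le_measure; rewrite ?inE//.
    by apply: measurable_box => i.
  move=> v /= vn; apply: (@le_trans _ _ (n%:R * n.+1%:R^-1)%R).
    apply: enorm_le_coord; last exact: ltW.
    by move=> i; have := vn i; rewrite /= in_itv/= -ler_norml.
  by rewrite ler_pdivrMr// mul1r ler_nat.
apply: (@le_lt_trans _ _ (mu (box (fun=> [set` `[- 1, 1]%R])))); last first.
  by rewrite lebesgue_rV_itv_box ?ltry// => i; case: (ge0_cp (@ler01 R)).
apply: le_measure; rewrite ?inE//; first by apply: measurable_box => i.
move=> v /= v1 i; rewrite /= in_itv/= -ler_norml.
exact: le_trans (coord_le_enorm _ _) v1.
Qed.

Context (T : 'rV[R]_n -> 'rV[R]_n).
Hypothesis mT : measurable_fun setT T.
Hypothesis TD : {morph T : x y / (x + y)%R}.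
Hypothesis Tsurj : forall y, exists x, T x = y.

Let measurable_funD_rV d (X : measurableType d) (f g : X -> 'rV[R]_n) :
  measurable_fun setT f -> measurable_fun setT g ->
  measurable_fun setT (fun x => f x + g x)%R.
Proof.
move=> /measurable_fun_coordP mf /measurable_fun_coordP mg.
apply/measurable_fun_coordP => i.
rewrite (_ : (fun _ => _) = (fun x => f x ord0 i + g x ord0 i)%R).
  exact: measurable_funD.
by apply/funext => x; rewrite mxE.
Qed.

Let measurable_funN_rV d (X : measurableType d) (f : X -> 'rV[R]_n) :
  measurable_fun setT f -> measurable_fun setT (fun x => - f x)%R.
Proof.
move=> /measurable_fun_coordP mf; apply/measurable_fun_coordP => i.
rewrite (_ : (fun _ => _) = (fun x => - f x ord0 i)%R).
  exact: measurableT_comp.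
by apply/funext => x; rewrite mxE.
Qed.

Let measurable_preimage d (X : measurableType d) (f : X -> 'rV[R]_n) A :
  measurable_fun setT f -> measurable A -> measurable (f @^-1` A).
Proof. by move=> mf mA; rewrite -[X in measurable X]setTI; exact: mf. Qed.

(** Integrate the indicator of A (T x) /\ B (T x + y) over (x, y).  Integrating
over y first gives the left-hand side, since the measure of B is invariant under
translation by T x.  Integrating over x first, the translation of x by a
T-preimage of - y turns the integrand into the indicator of
A (T x - y) /\ B (T x), whose integral is the right-hand side. *)
Lemma lebesgue_rV_swap A B : measurable A -> measurable B ->
  mu (T @^-1` A) * mu B = mu (T @^-1` B) * mu (-%R @^-1` A).
Proof.
move=> mA mB.
have mT1 : measurable_fun [set: 'rV[R]_n * 'rV[R]_n] (fun p => T p.1).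
  exact: (measurableT_comp mT).
have mD : measurable_fun [set: 'rV[R]_n * 'rV[R]_n] (fun p => T p.1 + p.2)%R.
  exact: measurable_funD_rV.
have mDA : measurable_fun [set: 'rV[R]_n * 'rV[R]_n] (fun p => T p.1 - p.2)%R.
  by apply: measurable_funD_rV => //; exact: measurable_funN_rV.
have mN : measurable (-%R @^-1` A).
  by apply: measurable_preimage => //; exact: (measurable_funN_rV (f := id)).
have mTA : measurable (T @^-1` A) by exact: measurable_preimage.
have mTB : measurable (T @^-1` B) by exact: measurable_preimage.
pose S1 := [set p : 'rV[R]_n * 'rV[R]_n | A (T p.1) /\ B (T p.1 + p.2)%R].
pose S2 := [set p : 'rV[R]_n * 'rV[R]_n | A (T p.1 - p.2)%R /\ B (T p.1)].
have mS1 : measurable S1.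
  by apply: measurableI; [exact: (measurable_preimage mT1)|exact: (measurable_preimage mD)].
have mS2 : measurable S2.
  by apply: measurableI; [exact: (measurable_preimage mDA)|exact: (measurable_preimage mT1)].
have F1 := @indic_fubini_tonelli _ _ _ _ _ mu mu S1 mS1.
have F2 := @indic_fubini_tonelli _ _ _ _ _ mu mu S2 mS2.
rewrite !(@indic_fubini_tonelli_FE _ _ _ _ _ mu) // in F1 F2.
rewrite !(@indic_fubini_tonelli_GE _ _ _ _ _ mu) // in F1 F2.
have -> : mu (T @^-1` A) * mu B = \int[mu]_x (mu \o xsection S1) x.
  rewrite -[T @^-1` A]setIT -integral_indic// -ge0_integralZr//; last first.
    by apply/measurable_EFinP; exact: measurable_indic.
  apply: eq_integral => x _ /=.
  have [ATx|nATx] := pselect (A (T x)).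
    rewrite indicE mem_set// mul1e -(lebesgue_rV_shift (T x))//; congr (mu _).
    rewrite xsectionE; apply/seteqP; split => y /=; rewrite addrC; last by case.
    by split.
  rewrite indicE memNset// mul0e -(measure0 mu); congr (mu _).
  by rewrite xsectionE; apply/seteqP; split => y /=; [|case].
have -> : mu (T @^-1` B) * mu (-%R @^-1` A) = \int[mu]_x (mu \o xsection S2) x.
  rewrite -[T @^-1` B]setIT -integral_indic// -ge0_integralZr//; last first.
    by apply/measurable_EFinP; exact: measurable_indic.
  apply: eq_integral => x _ /=.
  have [BTx|nBTx] := pselect (B (T x)).
    rewrite indicE mem_set// mul1e -(lebesgue_rV_shift (- T x))//; congr (mu _).
    rewrite xsectionE; apply/seteqP; split => y /=.
      by rewrite opprD opprK addrC.
    by rewrite opprD opprK addrC => -[].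
  rewrite indicE memNset// mul0e -(measure0 mu); congr (mu _).
  by rewrite xsectionE; apply/seteqP; split => y /=; [|case].
rewrite F1 F2; apply: eq_integral => y _ /=.
have [z zy] := Tsurj (- y)%R.
rewrite -(lebesgue_rV_shift z).
  congr (mu _); rewrite !ysectionE; apply/seteqP; split => x /=.
    by rewrite /S1 /S2 /= TD zy addrNK.
  by rewrite /S1 /S2 /= TD zy addrNK.
exact: measurable_ysection.
Qed.

End lebesgue_rV_isometry.

(** The unit ball [B] is its own preimage and has positive finite measure, so the
exchange identity says that the preimage of [A] has the measure of the opposite
of [A], which is the measure of [A] by the same identity for the identity map. *)
Lemma lebesgue_rV_isometry {R : realType} {n : nat}
    (T : 'rV[R]_n -> 'rV[R]_n) (A : set 'rV[R]_n) :
  measurable_fun setT T -> {morph T : x y / x + y} ->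
  (forall y, exists x, T x = y) -> (forall x, enorm (T x) = enorm x) ->
  measurable A -> lebesgue_rV n (T @^-1` A) = lebesgue_rV n A.
Proof.
move=> mT TD Tsurj Tiso mA.
pose B := [set v : 'rV[R]_n | enorm v <= 1].
have mB : measurable B by exact: measurable_unit_ball.
have /andP[B0 Boo] : (0 < lebesgue_rV n B < +oo)%E := lebesgue_unit_ball_gt0_lty.
have BE : T @^-1` B = B by apply/seteqP; split => v /=; rewrite /B /= Tiso.
have Bfin : lebesgue_rV n B \is a fin_num by rewrite ge0_fin_numE.
have h1 := lebesgue_rV_swap mT TD Tsurj mA mB.
have h2 : (lebesgue_rV n A * lebesgue_rV n B =
  lebesgue_rV n B * lebesgue_rV n (-%R @^-1` A))%E.
  by apply: (@lebesgue_rV_swap _ _ id) => // y; exists y.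
rewrite BE -h2 in h1.
have := congr1 (fun z => z * ((fine (lebesgue_rV n B))^-1)%:E)%E h1.
by rewrite -!muleA -(fineK Bfin) -EFinM mulfV ?mule1// gt_eqF// fine_gt0// B0.
Qed.

(** * Change of variables by a reflection *)

Section lebesgue_rV_refl.
Context {R : realType} {n : nat} (e : 'rV[R]_n) (l : R).
Hypothesis e1 : dot e e = 1.
Notation mu := (@lebesgue_rV R n).
Notation sigma := (refl e l).

Lemma lebesgue_rV_refl (A : set 'rV[R]_n) : measurable A ->
  mu (sigma @^-1` A) = mu A.
Proof.
move=> mA; have sE x : sigma x = refl e 0 x + (2 * l) *: e.
  by rewrite /refl subr0 mulrBr scalerBl opprB addrA addrAC.
have -> : sigma @^-1` A = refl e 0 @^-1` ((fun x => x + (2 * l) *: e) @^-1` A).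
  by apply/seteqP; split => x /=; rewrite sE.
rewrite lebesgue_rV_isometry ?lebesgue_rV_shift//.
- exact: measurable_refl.
- move=> x y; rewrite /refl !subr0 dotDl mulrDr scalerDl opprD.
  by rewrite addrACA.
- by move=> y; exists (refl e 0 y); rewrite reflK.
- move=> x; have := enorm_refl_sub 0 x 0 e1.
  have -> : refl e 0 0 = 0 :> 'rV[R]_n.
    by rewrite /refl dot0l subrr mulr0 scale0r subr0.
  by rewrite !subr0.
- rewrite -[X in measurable X]setTI.
  exact: (measurable_shift_rV _ measurableT mA).
Qed.

Local Open Scope ereal_scope.

Let pushforward_refl (A : set 'rV[R]_n) : measurable A ->
  pushforward mu sigma A = mu A.
Proof. exact: lebesgue_rV_refl. Qed.

Lemma integrable_refl (F : 'rV[R]_n -> \bar R) :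
  mu.-integrable setT F -> mu.-integrable setT (F \o sigma).
Proof.
move=> /integrableP[mF Foo]; apply/integrableP; split.
  by apply: measurableT_comp => //; exact: measurable_refl.
have := @ge0_integral_pushforward _ _ _ _ R sigma (measurable_refl e l) mu
  setT (fun x => `|F x|) measurableT.
rewrite preimage_setT /= => <- //; last exact: measurableT_comp.
rewrite -(@eq_measure_integral _ _ _ setT _ mu) => // [|mt A mA _].
  exact: measurable_refl.
exact/esym/pushforward_refl.
Qed.

Lemma integral_refl (F : 'rV[R]_n -> \bar R) :
  mu.-integrable setT F -> \int[mu]_x F (sigma x) = \int[mu]_x F x.
Proof.
move=> iF; have /integrableP[mF _] := iF.
have := @integral_pushforward _ _ _ _ R sigma (measurable_refl e l) mu setT F mF.
rewrite preimage_setT => /(_ (integrable_refl iF) measurableT) /= <-.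
apply: eq_measure_integral => [|mt A mA _]; first exact: measurable_refl.
exact: pushforward_refl.
Qed.

Lemma Rintegral_refl (f : 'rV[R]_n -> R) : mu.-integrable setT (EFin \o f) ->
  (\int[mu]_x f (sigma x) = \int[mu]_x f x)%R.
Proof. by move=> intf; congr fine; exact: (integral_refl intf). Qed.

End lebesgue_rV_refl.

(** * Comparing the fractional Laplacian at a point and at its reflection *)

(** Pointwise form of the maximum principle, with [a] and [b] the values of
u o sigma - u at [x] and [y], and [s], [t] the distances from [x] to [y] and to
the reflection of [y]. *)
Lemma pair_kernel_le {R : realType} (a b s t q : R) : a <= b -> 0 < s -> s <= t ->
  0 <= q -> (a - b) / s `^ q + (a + b) / t `^ q <= 2 * a / t `^ q.
Proof.
move=> ab s0 st q0; have t0 : 0 < t by exact: lt_le_trans st.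
have : (a - b) / s `^ q <= (a - b) / t `^ q.
  apply: ler_wnM2l; first by rewrite subr_le0.
  rewrite lef_pV2 ?posrE ?powR_gt0//.
  apply: ge0_ler_powR => //; rewrite nnegrE; exact: ltW.
move=> h; rewrite (le_trans (lerD h (lexx _)))// -mulrDl.
by rewrite (_ : a - b + (a + b) = 2 * a)//; ring.
Qed.

Section indicator.
Context d (T : measurableType d) (R : realType) (mu : {measure set T -> \bar R}).

Lemma integrable_indic_lty A : measurable A -> (mu A < +oo)%E ->
  mu.-integrable setT (EFin \o \1_A).
Proof.
move=> mA muA; apply/integrableP; split; first exact/measurable_EFinP.
rewrite (eq_integral (fun x => (\1_A x)%:E)) ?integral_indic ?setIT//.
by move=> x _; rewrite /= ger0_norm.
Qed.

Lemma Rintegral_indic A : measurable A ->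
  \int[mu]_y \1_A y = fine (mu A).
Proof. by move=> mA; rewrite /Rintegral integral_indic ?setIT. Qed.

Lemma integrable_Radd (f g : T -> R) : mu.-integrable setT (EFin \o f) ->
  mu.-integrable setT (EFin \o g) ->
  mu.-integrable setT (EFin \o (fun y => f y + g y)).
Proof. exact: integrableD. Qed.

Lemma integrable_Rsub (f g : T -> R) : mu.-integrable setT (EFin \o f) ->
  mu.-integrable setT (EFin \o g) ->
  mu.-integrable setT (EFin \o (fun y => f y - g y)).
Proof. exact: integrableB. Qed.

Lemma integrable_Rscale (k : R) (f : T -> R) : mu.-integrable setT (EFin \o f) ->
  mu.-integrable setT (EFin \o (fun y => k * f y)).
Proof. exact: integrableZl. Qed.

End indicator.

Lemma Rintegral_refl_sub {R : realType} n (e : 'rV[R]_n) l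
    (f g : 'rV[R]_n -> R) : dot e e = 1 ->
  (@lebesgue_rV R n).-integrable setT (EFin \o f) ->
  (@lebesgue_rV R n).-integrable setT (EFin \o g) ->
  \int[@lebesgue_rV R n]_y f y - \int[@lebesgue_rV R n]_y g y =
  \int[@lebesgue_rV R n]_y (f (refl e l y) - g y).
Proof.
move=> e1 fi gi.
rewrite (RintegralB measurableT (@integrable_refl R n e l e1 _ fi) gi).
by rewrite (@Rintegral_refl R n e l e1 _ fi).
Qed.

Lemma Rintegral_refl_sym {R : realType} n (e : 'rV[R]_n) l
    (f : 'rV[R]_n -> R) : dot e e = 1 ->
  (@lebesgue_rV R n).-integrable setT (EFin \o f) ->
  2 * \int[@lebesgue_rV R n]_y f y =
  \int[@lebesgue_rV R n]_y (f y + f (refl e l y)).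
Proof.
move=> e1 fi.
rewrite (RintegralD measurableT fi (@integrable_refl R n e l e1 _ fi)).
by rewrite (@Rintegral_refl R n e l e1 _ fi) mulrDl !mul1r.
Qed.

Section truncated_difference.
Context {R : realType} {N : nat} (alpha : R) (u : 'rV[R]_N -> R).
Hypothesis alpha0 : 0 < alpha.
Context (e : 'rV[R]_N) (l : R).
Hypothesis e1 : dot e e = 1.
Notation mu := (@lebesgue_rV R N).
Notation sigma := (refl e l).
Notation p := (N%:R + 2 * alpha).

Definition antisym y := u (refl e l y) - u y.
Notation w := antisym.

Lemma antisym_refl y : w (sigma y) = - w y.
Proof. by rewrite /w reflK// opprB. Qed.

Definition far (x : 'rV[R]_N) (r : R) : set 'rV[R]_N :=
  [set y | r <= enorm (x - y)].

Lemma measurable_far x r : measurable (far x r).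
Proof.
rewrite -[X in measurable X]setTI.
rewrite (_ : far x r = (fun y => enorm (y - x)) @^-1` [set` `[r, +oo[]).
  apply: (measurableT_comp measurable_enorm (measurable_shift_rV (- x))) => //.
by apply/seteqP; split => y /=; rewrite in_itv/= andbT enormB.
Qed.

Let phi (x : 'rV[R]_N) (r : R) (y : 'rV[R]_N) : R :=
  ((fun y => (w x - w y) / enorm (x - y) `^ p) \_ (far x r)) y.

Lemma integrable_trunc x r : 0 < r -> fracLap_defined alpha u x ->
  mu.-integrable setT (EFin \o (fracLap_integrand alpha u x \_ (far x r))).
Proof.
move=> r0 [/(_ r r0) + _]; rewrite integrable_mkcond; last exact: measurable_far.
by rewrite -restrict_EFin.
Qed.

Lemma truncE x r :
  fracLap_trunc alpha u x r = \int[mu]_y (fracLap_integrand alpha u x \_ (far x r)) y.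
Proof. exact: Rintegral_mkcond. Qed.

Let phiE x r : phi x r = fun y =>
  (fracLap_integrand alpha u (sigma x) \_ (far (sigma x) r)) (sigma y) -
  (fracLap_integrand alpha u x \_ (far x r)) y.
Proof.
apply/funext => y; rewrite /phi !patchE.
have -> : (sigma y \in far (sigma x) r) = (y \in far x r).
  by apply/idP/idP; rewrite !inE /far /= enorm_refl_sub.
have [_|_] := boolP (y \in far x r); last by rewrite subr0.
rewrite /fracLap_integrand enorm_refl_sub// -mulrBl; congr (_ / _).
by rewrite /w; ring.
Qed.

Let integrable_phi x r : 0 < r ->
  fracLap_defined alpha u x -> fracLap_defined alpha u (sigma x) ->
  mu.-integrable setT (EFin \o phi x r).
Proof.
move=> r0 dx dsx; rewrite phiE.
apply: integrable_Rsub; last exact: integrable_trunc.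
exact: (@integrable_refl R N e l e1 _ (integrable_trunc r0 dsx)).
Qed.

Lemma trunc_diff x r : 0 < r ->
  fracLap_defined alpha u x -> fracLap_defined alpha u (sigma x) ->
  fracLap_trunc alpha u (sigma x) r - fracLap_trunc alpha u x r =
  \int[mu]_y phi x r y.
Proof.
move=> r0 dx dsx; rewrite (truncE (sigma x)) (truncE x) phiE.
exact: (@Rintegral_refl_sub R N e l _ _ e1 (integrable_trunc r0 dsx) (integrable_trunc r0 dx)).
Qed.

Let integral_phi_sym x r : 0 < r ->
  fracLap_defined alpha u x -> fracLap_defined alpha u (sigma x) ->
  2 * \int[mu]_y phi x r y = \int[mu]_y (phi x r y + phi x r (sigma y)).
Proof.
move=> r0 dx dsx; have ip := integrable_phi r0 dx dsx.
exact: (@Rintegral_refl_sym R N e l _ e1 ip).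
Qed.

Lemma lebesgue_ball_le x r : 0 < r ->
  (mu (~` far x r) <= ((2 * r) ^+ N)%:E)%E.
Proof.
move=> r0; rewrite -(lebesgue_cube x (ltW r0)).
apply: le_measure; rewrite ?inE.
- by apply: measurableC; exact: measurable_far.
- exact: measurable_cube.
move=> y /= /negP; rewrite -ltNge => xy i; rewrite /= in_itv/=.
have := le_lt_trans (coord_le_enorm (x - y) i) xy.
by rewrite !mxE distrC ltr_distl => /andP[? ?]; rewrite !ltW.
Qed.

(** The symmetrized integrand phi y + phi (sigma y) is at most [- k] on [Q] and
nonpositive elsewhere on the half-space, except inside the excluded ball.  There
only the reflected term survives the truncation, so the cancellation is lost and
the error [E] appears; it is harmless because the ball shrinks. *)
Lemma trunc_diff_le x Q (k E r : R) : 0 < r -> r <= dot x e - l ->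
  fracLap_defined alpha u x -> fracLap_defined alpha u (sigma x) ->
  measurable Q -> (mu Q < +oo)%E -> 0 <= k -> 0 <= E ->
  (forall y, Q y -> l < dot y e /\ r <= enorm (x - y)) ->
  w x <= 0 -> (forall y, l <= dot y e -> w x <= w y) ->
  (forall y, Q y -> (w x - w y) / enorm (x - y) `^ p +
     (w x + w y) / enorm (x - sigma y) `^ p <= - k) ->
  (forall y, enorm (x - y) < r ->
     (w x + w y) / enorm (x - sigma y) `^ p <= E) ->
  fracLap_trunc alpha u (sigma x) r - fracLap_trunc alpha u x r <=
  E * fine (mu (~` far x r)) - k / 2 * fine (mu Q).
Proof.
move=> r0 rd dx dsx mQ muQ k0 E0 QP wx0 wmin kQ EB.
have p0 : 0 < p by rewrite ltr_wpDl ?mulr_gt0.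
pose B := ~` far x r.
have mB : measurable B by apply: measurableC; exact: measurable_far.
have muB : (mu B < +oo)%E by apply: le_lt_trans (lebesgue_ball_le _ r0) (ltry _).
pose H y := E * (\1_B y + \1_B (sigma y)) - k * \1_Q y.
have iB := integrable_indic_lty mB muB.
have iBs := @integrable_refl R N e l e1 _ iB.
have iQ := integrable_indic_lty mQ muQ.
have iBB := integrable_Rscale E (integrable_Radd iB iBs).
have ikQ := integrable_Rscale k iQ.
have iH : mu.-integrable setT (EFin \o H) by exact: integrable_Rsub.
have IH : \int[mu]_y H y = 2 * (E * fine (mu B)) - k * fine (mu Q).
  rewrite (RintegralB measurableT iBB ikQ).
  rewrite (RintegralZl _ measurableT (integrable_Radd iB iBs)).
  rewrite (RintegralZl _ measurableT iQ).
  rewrite -(@Rintegral_refl_sym R N e l _ e1 iB) !Rintegral_indic//.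
  by rewrite mulrCA.
(* the excluded ball stays on the side of [x] *)
have phi_out y : dot y e <= l -> phi x r y = (w x - w y) / enorm (x - y) `^ p.
  move=> yl; rewrite /phi patchE mem_set// /far /=.
  rewrite (le_trans rd)//; apply: (@le_trans _ _ (dot (x - y) e)).
    by rewrite dotDl dotNl lerD2l lerN2.
  by rewrite (le_trans (dot_le_enorm _ _))// [enorm e]enormE e1 sqrtr1 mulr1.
have phi_sym y : l <= dot y e ->
    phi x r (sigma y) = (w x + w y) / enorm (x - sigma y) `^ p.
  move=> ly; rewrite phi_out ?antisym_refl ?opprK// dot_refl//.
  by rewrite lerBlDr mulr2n mulrDl mul1r lerD2l.
(* the symmetrized integrand takes the same value at sigma y *)
have half y : l <= dot y e -> phi x r y + phi x r (sigma y) <= H y.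
  move=> ly; rewrite phi_sym// /H.
  have EBs : 0 <= E * \1_B (sigma y) by rewrite mulr_ge0.
  have [By|nBy] := pselect (B y).
    have nyQ : ~ Q y by move=> /QP[_]; exact: By.
    have -> : phi x r y = 0.
      by rewrite /phi patchE memNset.
    rewrite add0r !indicE [y \in Q]memNset// [y \in B]mem_set//= mulr0 subr0.
    rewrite mulrDr mulr1 ler_wpDr// EB// ltNge.
    exact/negP.
  have fary : far x r y by apply: contrapT.
  have -> : phi x r y = (w x - w y) / enorm (x - y) `^ p.
    by rewrite /phi patchE mem_set.
  rewrite mulrDr [\1_B y]indicE memNset// mulr0 add0r [\1_Q y]indicE.
  have [Qy|nQy] := pselect (Q y).
    rewrite (mem_set Qy) mulr1 (le_trans (kQ _ Qy))//.
    by rewrite lerDr.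
  rewrite (memNset nQy) mulr0 subr0 (le_trans _ EBs)//.
  have xy0 : 0 < enorm (x - y) by exact: lt_le_trans r0 fary.
  have xyle : enorm (x - y) <= enorm (x - sigma y).
    by apply: le_enorm_sub_refl => //; rewrite -subr_ge0 (le_trans (ltW r0)).
  rewrite (le_trans (pair_kernel_le (wmin _ ly) xy0 xyle (ltW p0)))//.
  by rewrite pmulr_lle0 ?invr_gt0 ?powR_gt0 ?(lt_le_trans xy0)// pmulr_rle0.
have GH y : phi x r y + phi x r (sigma y) <= H y.
  have [|yl] := leP l (dot y e); first exact: half.
  have lsy : l <= dot (sigma y) e.
    by rewrite dot_refl// lerBrDr mulr2n mulrDl mul1r lerD2l ltW.
  have hs := half _ lsy.
  rewrite reflK// in hs.
  rewrite [leLHS]addrC; apply: (le_trans hs).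
  rewrite /H reflK// [\1_B (sigma y) + _]addrC lerD2l lerN2.
  have nQy : ~ Q y by move=> /QP[]; rewrite ltNge (ltW yl).
  by rewrite [\1_Q y]indicE memNset// mulr0 mulr_ge0.
rewrite trunc_diff// -(@ler_pM2l _ 2)// integral_phi_sym//.
apply: (@le_trans _ _ (\int[mu]_y H y)).
  apply: le_Rintegral => //.
  have ip := integrable_phi r0 dx dsx.
  exact: (integrable_Radd ip (@integrable_refl R N e l e1 _ ip)).
rewrite IH mulrBr lerD2l lerN2 mulrA.
by rewrite [2 * _]mulrC divfK.
Qed.

End truncated_difference.

(** The bound produced by the cube of [fracLap_narrow], where [a], [b], [c], [d]
stand for 4^p, r^(2 alpha), r^N and N^N, with r the distance to the hyperplane. *)
Lemma box_bound_simplify {R : realType} (a b c d t : R) :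
  a != 0 -> b != 0 -> c != 0 -> d != 0 ->
  - (- (2 * t / (a * (c * b))) / 2 * (c / d)) = t / (a * d) / b.
Proof. by move=> a0 b0 c0 d0; field; rewrite a0 b0 c0 d0. Qed.
Section comparison.
Context {R : realType} {N : nat} (alpha : R) (u : 'rV[R]_N -> R).
Hypothesis alpha0 : 0 < alpha.
Hypothesis cu : continuous u.
Context (e : 'rV[R]_N) (l : R).
Hypothesis e1 : dot e e = 1.
Notation mu := (@lebesgue_rV R N).
Notation sigma := (refl e l).
Notation p := (N%:R + 2 * alpha).
Notation w := (antisym u e l).

Lemma continuous_antisym : continuous w.
Proof.
move=> x; apply: (@cvgB R _ _ (nbhs x)); last exact: cu.
by apply: continuous_comp; [exact: continuous_refl|exact: cu].
Qed.

(** Principal value form of [trunc_diff_le]: by continuity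
w x + w y <= w y - w x <= eta d^p near [x], so the error term is at most [eta]
times the measure of a ball, and it disappears in the limit. *)
Lemma fracLap_diff_le x Q (k rho : R) : l < dot x e ->
  fracLap_defined alpha u x -> fracLap_defined alpha u (sigma x) ->
  measurable Q -> (mu Q < +oo)%E -> 0 <= k -> 0 < rho ->
  (forall y, Q y -> l < dot y e /\ rho <= enorm (x - y)) ->
  w x <= 0 -> (forall y, l <= dot y e -> w x <= w y) ->
  (forall y, Q y -> (w x - w y) / enorm (x - y) `^ p +
     (w x + w y) / enorm (x - sigma y) `^ p <= - k) ->
  fracLap alpha u (sigma x) - fracLap alpha u x <= - (k / 2 * fine (mu Q)).
Proof.
move=> lx dx dsx mQ muQ k0 rho0 QP wx0 wmin kQ.
have p0 : 0 < p by rewrite ltr_wpDl ?mulr_gt0.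
pose d := dot x e - l.
have d0 : 0 < d by rewrite subr_gt0.
have dp0 : 0 < d `^ p by exact: powR_gt0.
apply/ler_addgt0Pr => eta eta0.
have [del del0 delP] : exists2 del : R, 0 < del &
    forall y, enorm (x - y) < del -> w y < w x + eta * d `^ p.
  apply: (@nbhs_enormP _ _ _ [set y | w y < w x + eta * d `^ p]).
  apply: (@cvgr_lt R _ (nbhs x) _ w (w x)); first exact: continuous_antisym.
  by rewrite ltrDl mulr_gt0.
have [_ cx] := dx; have [_ csx] := dsx.
have cd : fracLap_trunc alpha u (sigma x) r - fracLap_trunc alpha u x r @[r --> 0^'+]
    --> fracLap alpha u (sigma x) - fracLap alpha u x.
  exact: (@cvgB R _ _ (0^'+) _ _ _ _ _ csx cx).
apply: (cvgr_to_le cd).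
have r1 : 0 < 2^-1 :> R by rewrite invr_gt0.
near=> r.
have r0 : 0 < r by near: r; exact: nbhs_right_gt.
have rd : r <= d by near: r; exact: nbhs_right_le.
have rdel : r <= del by near: r; exact: nbhs_right_le.
have rrho : r <= rho by near: r; exact: nbhs_right_le.
have rhalf : r <= 2^-1 by near: r; exact: nbhs_right_le.
have h : fracLap_trunc alpha u (sigma x) r - fracLap_trunc alpha u x r <=
    eta * fine (mu (~` far x r)) - k / 2 * fine (mu Q).
  apply: trunc_diff_le => //; first exact: ltW.
    by move=> y /QP[ly xy]; split => //; exact: le_trans xy.
  move=> y xy.
  have ly : l <= dot y e.
    have := le_trans (dot_le_enorm (x - y) e) (_ : _ <= d).
    rewrite [enorm e]enormE e1 sqrtr1 mulr1 dotDl dotNl.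
    move=> /(_ (le_trans (ltW xy) rd)); rewrite /d; lra.
  have dxy : d <= enorm (x - sigma y).
    apply: (@le_trans _ _ (dot (x - sigma y) e)).
      by rewrite dotDl dotNl dot_refl// /d; lra.
    by rewrite (le_trans (dot_le_enorm _ _))// [enorm e]enormE e1 sqrtr1 mulr1.
  rewrite ler_pdivrMr ?powR_gt0//; last exact: lt_le_trans dxy.
  apply: (@le_trans _ _ (eta * d `^ p)).
    have := delP y (lt_le_trans xy rdel); lra.
  rewrite ler_pM2l//; apply: ge0_ler_powR; rewrite ?nnegrE ?enorm_ge0//.
    exact: ltW.
  exact: ltW.
(* radii below 1/2 make the measure of the excluded ball at most 1 *)
rewrite (le_trans h)// addrC lerD2l ger_pMr//.
rewrite -lee_fin fineK; last first.
  rewrite ge0_fin_numE//; exact: le_lt_trans (lebesgue_ball_le x r0) (ltry _).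
rewrite (le_trans (lebesgue_ball_le x r0))// lee_fin exprn_ile1//.
  by rewrite mulr_ge0// ltW.
by rewrite -ler_pdivlMl// mulr1.
Unshelve. all: by end_near. Qed.

(** Take for [Q] a cube of size comparable to the distance d = x.e - l, centered
at x + d e: it avoids the ball of radius d/2 around [x], and its points have
reflections within 4 d of [x]. *)
Lemma fracLap_narrow x : (0 < N)%N -> l < dot x e ->
  fracLap_defined alpha u x -> fracLap_defined alpha u (sigma x) ->
  w x < 0 -> (forall y, l <= dot y e -> w x <= w y) ->
  fracLap alpha u (sigma x) - fracLap alpha u x <=
  w x * (4 `^ p * N%:R ^+ N)^-1 / (dot x e - l) `^ (2 * alpha).
Proof.
move=> N0 lx dx dsx wx0 wmin; have d0 : 0 < dot x e - l by rewrite subr_gt0.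
set d := dot x e - l in d0 *.
have p0 : 0 < p by rewrite ltr_wpDl ?mulr_gt0.
have n0 : 0 < N%:R :> R by rewrite ltr0n.
have dp0 : 0 < (4 * d) `^ p by rewrite powR_gt0 ?mulr_gt0.
pose z := x + d *: e; pose rho := d / (2 * N%:R).
have rho0 : 0 < rho by rewrite divr_gt0 ?mulr_gt0.
have enorm_e : enorm e = 1 by rewrite enormE e1 sqrtr1.
have nrho : N%:R * rho = d / 2.
  by rewrite /rho invfM mulrCA [_^-1 * _]mulrC mulVKf ?gt_eqF.
have Qz y : cube z rho y ->
    [/\ d / 2 <= dot y e - dot x e, dot y e - l <= 5 / 2 * d,
        d / 2 <= enorm (x - y) & enorm (x - y) <= 3 / 2 * d].
  move=> /(enorm_cube (ltW rho0)); rewrite nrho => zy.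
  have xz : enorm (x - z) = d.
    by rewrite /z opprD addrA subrr add0r enormN enormZ enorm_e mulr1 gtr0_norm.
  have h1 := le_trans (dot_unit_le (z - y) e1) zy.
  have h2 : dot (y - z) e <= d / 2.
    by rewrite (le_trans (dot_unit_le _ e1))// enormB.
  rewrite /z !dotE e1 mulr1 in h1 h2.
  have h3 := enorm_distD y x z; have h4 := enorm_distD z x y.
  rewrite xz [enorm (y - z)]enormB in h3; rewrite xz in h4.
  have dE : d = dot x e - l by [].
  clear - h1 h2 h3 h4 zy dE; clearbody d; split; lra.
pose k := - (2 * w x / (4 * d) `^ p).
have k0 : 0 <= k.
  by rewrite oppr_ge0 pmulr_lle0 ?invr_gt0// pmulr_rle0// ltW.
have := @fracLap_diff_le x (cube z rho) k (d / 2) lx dx dsx.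
rewrite lebesgue_cube ?(ltW rho0)// => h.
apply: le_trans (h _ _ _ _ _ _ _ _) _ => //.
- exact: measurable_cube.
- exact: ltry.
- by rewrite divr_gt0.
- move=> y /Qz[h1 h2 h3 h4]; split => //.
  clear - d0 h1; rewrite /d in d0 h1 *; lra.
- exact: ltW.
- move=> y /Qz[h1 h2 h3 h4].
  have ly : l <= dot y e by clear - d0 h1; rewrite /d in d0 h1 *; lra.
  have xy0 : 0 < enorm (x - y) by rewrite (lt_le_trans _ h3)// divr_gt0.
  have xyle := le_enorm_sub_refl e1 (ltW lx) ly.
  rewrite (le_trans (pair_kernel_le (wmin _ ly) xy0 xyle (ltW p0)))//.
  rewrite /k opprK.
  apply: ler_wnM2l; first by rewrite pmulr_rle0// ltW.
  rewrite lef_pV2 ?posrE ?dp0 ?powR_gt0 ?(lt_le_trans xy0)//.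
  apply: ge0_ler_powR; rewrite ?nnegrE ?enorm_ge0 ?(ltW p0) ?mulr_ge0 ?(ltW d0)//.
  rewrite -(@ler_pXn2r _ 2) ?nnegrE ?enorm_ge0 ?mulr_ge0 ?(ltW d0)//.
  rewrite sqr_enorm_sub_refl// -/d.
  have : enorm (x - y) ^+ 2 <= (3 / 2 * d) ^+ 2.
    by rewrite ler_pXn2r ?nnegrE ?enorm_ge0// mulr_ge0 ?(ltW d0)// divr_ge0.
  have : (dot x e - l) * (dot y e - l) <= d * (5 / 2 * d).
    by rewrite -/d ler_pM2l.
  rewrite -/d; move: (enorm (x - y) ^+ 2) => a; clear; clearbody d.
  move: (dot y e - l) => b; rewrite -[4 * d * b]mulrA; move: (d * b) => c.
  rewrite !expr2; nra.
have kE : (4 * d) `^ p = 4 `^ p * (d ^+ N * d `^ (2 * alpha)).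
  rewrite powRM ?(ltW d0)//; congr (_ * _).
  by rewrite powRD ?powR_mulrn ?(ltW d0)// gt_eqF ?d0 ?implybT.
have rhoE : 2 * rho = d / N%:R by rewrite /rho invfM mulrCA mulVKf.
rewrite /k rhoE kE /= expr_div_n le_eqVlt; apply/orP; left; apply/eqP.
have h4 : 4 `^ p != 0 by rewrite gt_eqF ?powR_gt0.
have hd : d `^ (2 * alpha) != 0 by rewrite gt_eqF ?powR_gt0.
have hdN : d ^+ N != 0 by rewrite gt_eqF ?exprn_gt0.
have hN : N%:R ^+ N != 0 :> R by rewrite gt_eqF ?exprn_gt0.
exact: box_bound_simplify.
Qed.

(** The kernel is continuous and negative at [y0], because [x] is strictly closer
to [y0] than to its reflection; so it is bounded away from 0 on a small cube. *)
Lemma fracLap_strict x y0 : (0 < N)%N -> l < dot x e -> l < dot y0 e ->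
  fracLap_defined alpha u x -> fracLap_defined alpha u (sigma x) ->
  w x = 0 -> (forall y, l <= dot y e -> 0 <= w y) -> 0 < w y0 ->
  fracLap alpha u (sigma x) < fracLap alpha u x.
Proof.
move=> N0 lx ly0 dx dsx wx0 wmin wy0.
have p0 : 0 < p by rewrite ltr_wpDl ?mulr_gt0.
have n0 : 0 < N%:R :> R by rewrite ltr0n.
have xy0 : 0 < enorm (x - y0).
  rewrite enorm_gt0// subr_eq0; apply: contraTneq wy0 => <-.
  by rewrite wx0 ltxx.
pose g y := - w y / enorm (x - y) `^ p + w y / enorm (x - sigma y) `^ p.
have xsy0 : enorm (x - y0) < enorm (x - sigma y0).
  exact: lt_enorm_sub_refl.
have gy0 : g y0 < 0.
  rewrite /g mulNr addrC subr_lt0 ltr_pM2l// ltf_pV2 ?posrE ?powR_gt0//.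
    by apply: gt0_ltr_powR; rewrite ?nnegrE ?enorm_ge0.
  exact: lt_trans xsy0.
have cg : {for y0, continuous g}.
  have ck (h : 'rV[R]_N -> 'rV[R]_N) : continuous h -> 0 < enorm (x - h y0) ->
      {for y0, continuous (fun y => (enorm (x - h y) `^ p)^-1)}.
    move=> ch hy0; apply: (@cvgV R _ (nbhs y0)).
      by rewrite gt_eqF ?powR_gt0.
    apply: (@continuous_comp _ _ _ (fun y => enorm (x - h y)) (@powR R ^~ p)).
      apply: continuous_comp; last exact: continuous_enorm.
      by apply: (@cvgB R _ _ (nbhs y0)); [exact: cvg_cst|exact: ch].
    exact: powR_continuous.
  apply: (@cvgD R _ _ (nbhs y0)); apply: (@cvgM R _ (nbhs y0)).
  - by apply: (@cvgN R _ _ (nbhs y0)); exact: continuous_antisym.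
  - by apply: (ck (fun y => y)) => // y; exact: cvg_id.
  - exact: continuous_antisym.
  - by apply: (ck (refl e l)); [exact: continuous_refl|exact: lt_trans xsy0].
have [del del0 delP] : exists2 del : R, 0 < del &
    forall y, enorm (y0 - y) < del -> g y < g y0 / 2.
  apply: (@nbhs_enormP _ _ _ [set y | g y < g y0 / 2]).
  apply: (@cvgr_lt R _ (nbhs y0) _ g (g y0)); first exact: cg.
  by move: gy0; move: (g y0) => a; lra.
pose rho := Num.min (Num.min (del / 2) (enorm (x - y0) / 2)) ((dot y0 e - l) / 2).
have rho0 : 0 < rho by rewrite /rho !lt_min !divr_gt0 ?subr_gt0.
have rn0 : 0 < rho / N%:R by rewrite divr_gt0.
have rdel : rho < del.
  by rewrite /rho !gt_min gtr_pMr// invf_lt1// ltr1n.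
have rxy : rho <= enorm (x - y0) / 2 by rewrite /rho !ge_min lexx orbT.
have rly : rho <= (dot y0 e - l) / 2 by rewrite /rho !ge_min lexx orbT.
have Qy y : cube y0 (rho / N%:R) y ->
    [/\ enorm (y0 - y) <= rho, l < dot y e & enorm (x - y0) / 2 <= enorm (x - y)].
  move=> /(enorm_cube (ltW rn0)); rewrite mulrCA divff ?gt_eqF// mulr1 => h.
  split=> //.
    have := le_trans (dot_unit_le (y0 - y) e1) h.
    rewrite !dotE; move: rly ly0; lra.
  have := enorm_distD y x y0; rewrite [enorm (y - y0)]enormB.
  move: h rxy; lra.
have := @fracLap_diff_le x (cube y0 (rho / N%:R)) (- (g y0 / 2)) (enorm (x - y0) / 2) lx dx dsx.
rewrite lebesgue_cube ?(ltW rn0)// => h.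
rewrite -subr_lt0; apply: le_lt_trans (h _ _ _ _ _ _ _ _) _ => //.
- exact: measurable_cube.
- exact: ltry.
- by rewrite oppr_ge0 pmulr_lle0// ltW.
- by rewrite divr_gt0.
- by move=> y /Qy[].
- by rewrite wx0.
- by move=> y /wmin; rewrite wx0.
- move=> y /Qy[h1 _ _]; rewrite wx0 !sub0r add0r opprK.
  by rewrite ltW// delP// (le_lt_trans h1).
rewrite oppr_lt0 !mulr_gt0// ?oppr_gt0 ?exprn_gt0 ?mulr_gt0//.
- by rewrite pmulr_llt0.
- by rewrite invr_gt0.
Qed.

End comparison.

(** * Nonlinearity, decay and existence of minima *)

(** The local Lipschitz condition is about pairs, so compactness of the square
[0, M] x [0, M] yields a common constant directly, also for distant pairs. *)
Lemma lipschitz_segment {R : realType} (f : R -> R) (M : R) :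
  [locally [lipschitz f s | s in [set s : R | 0 <= s]]] ->
  exists2 L, 0 < L & forall a b, 0 <= a <= M -> 0 <= b <= M ->
    `|f a - f b| <= L * `|a - b|.
Proof.
move=> lf.
pose P (L : R) (z : R * R) := `|f z.1 - f z.2| <= L * `|z.1 - z.2|.
have cK : compact (`[0, M]%classic `*` `[0, M]%classic : set (R * R)).
  by apply: compact_setX; exact: segment_compact.
have : \forall L \near +oo, (`[0, M]%classic `*` `[0, M]%classic) `<=` P L.
  move/compact_near_coveringP/near_covering_withinP : cK; apply.
  move=> z [/=]; rewrite !in_itv/= => /andP[z10 z1M] /andP[z20 z2M].
  have /= lfz := lf z (conj z10 z20).
  have [L [Lr LP]] := lfz.
  have L1 : \forall z' \near z, ([set s : R | 0 <= s] `*` [set s : R | 0 <= s]) z' ->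
      P (L + 1) z'.
    by apply: (LP (L + 1)); rewrite ltrDl.
  exists ([set z' | ([set s : R | 0 <= s] `*` [set s : R | 0 <= s]) z' ->
      P (L + 1) z'], [set L' | L + 1 < L']).
    split; first exact: L1.
    by exists (L + 1); rewrite num_real.
  move=> [z' L'] /= [Pz LL'] [/andP[z'10 _] /andP[z'20 _]].
  apply: (le_trans (Pz (conj z'10 z'20))).
  by rewrite ler_wpM2r// ltW.
move=> nL; near (pinfty_nbhs R) => L.
exists L; first by near: L; exact: nbhs_pinfty_gt.
have LP : (`[0, M]%classic `*` `[0, M]%classic) `<=` P L by near: L.
move=> a b aM bM; apply: (LP (a, b)).
by split; rewrite /= in_itv.
Unshelve. all: by end_near. Qed.

Definition negative_minimum {R : realType} {N : nat} (u : 'rV[R]_N -> R) e l x :=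
  [/\ l < dot x e, antisym u e l x < 0 &
      forall y, l <= dot y e -> antisym u e l x <= antisym u e l y].

Section decay_at_infinity.
Context {R : realType} {N : nat} (u : 'rV[R]_N -> R).
Hypothesis cu : continuous u.
Hypothesis u0 : forall x, 0 < u x.
Hypothesis ulim : u x @[x --> at_infinity] --> (0 : R).

Lemma at_infinityP (P : set 'rV[R]_N) : at_infinity P ->
  exists2 r, 0 < r & forall x, r < enorm x -> P x.
Proof.
move=> [r _ rP]; exists (Num.max 1 r); first by rewrite lt_max ltr01.
by move=> x; rewrite gt_max => /andP[_ /rP].
Qed.

Lemma small_at_infinity (eta : R) : 0 < eta ->
  exists2 r, 0 < r & forall x, r < enorm x -> u x < eta.
Proof. by move=> eta0; apply: at_infinityP; exact: (cvgr_lt 0 ulim). Qed.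

Lemma closed_ball_compact (r : R) : compact [set x : 'rV[R]_N | enorm x <= r].
Proof.
apply: bounded_closed_compact.
  exists r; split; first exact: num_real.
  move=> M rM x /= xr; rewrite -[`|x|]/(mx_norm x) mx_normrE.
  have M0 : 0 <= M by rewrite (le_trans (enorm_ge0 x))// (le_trans xr)// ltW.
  apply/bigmax_leP; split => // -[i j] _ /=; rewrite (ord1 i).
  by rewrite (le_trans (coord_le_enorm _ _))// (le_trans xr)// ltW.
rewrite (_ : [set _ | _] = @enorm R N @^-1` [set t | t <= r])//.
by apply: closed_comp; [move=> x _; exact: continuous_enorm|exact: closed_le].
Qed.

Lemma exists_maximum : exists x0, forall x, u x <= u x0.
Proof.
have [r r0 rP] := small_at_infinity (u0 0).
have K0 : [set x : 'rV[R]_N | enorm x <= r] !=set0.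
  by exists 0; rewrite /= enorm0 ltW.
have [|c cK cP] := EVT_max_rV K0 (closed_ball_compact (r := r)) (f := u).
  exact: continuous_subspaceT.
exists c => x; have [xr|rx] := leP (enorm x) r; first by apply: cP; rewrite inE.
rewrite (le_trans (ltW (rP _ rx)))// cP// inE /= enorm0; exact: ltW.
Qed.

Context (e : 'rV[R]_N) (l : R).
Notation w := (antisym u e l).

Lemma antisym_hyperplane y : dot y e = l -> w y = 0.
Proof.
by move=> yl; rewrite /antisym /refl yl subrr mulr0 scale0r subr0 subrr.
Qed.

(** Outside a large ball w > - u is above the given negative value, so the
minimum over the half-space is a minimum over a compact set; it is not on the
hyperplane, where w vanishes. *)
Lemma exists_negative_minimum y1 : l <= dot y1 e -> w y1 < 0 ->
  exists x, negative_minimum u e l x.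
Proof.
move=> ly1 wy1; have eta0 : 0 < - w y1 by rewrite oppr_gt0.
have [r r0 rP] := small_at_infinity eta0.
pose rho := Num.max r (enorm y1).
pose K := [set x : 'rV[R]_N | enorm x <= rho] `&` [set x | l <= dot x e].
have Ky1 : K y1 by split => //=; rewrite /rho le_max lexx orbT.
have cK : compact K.
  apply: (subclosed_compact _ (@closed_ball_compact rho)); last by move=> x [].
  apply: closedI; first exact: compact_closed (closed_ball_compact (r := rho)).
  rewrite (_ : [set _ | _] = (fun x => dot x e) @^-1` [set t | l <= t])//.
  by apply: closed_comp; [move=> x _; exact: continuous_dotl|exact: closed_ge].
have [||c cK' cP] := EVT_min_rV _ cK (f := w).
- by exists y1.
- by apply: continuous_subspaceT; exact: continuous_antisym.
have wc : w c <= w y1 by apply: cP; rewrite inE.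
exists c; split.
- move: cK'; rewrite inE => -[_ /=]; rewrite le_eqVlt => /predU1P[lc|//].
  by move: wc; rewrite antisym_hyperplane// leNgt wy1.
- exact: le_lt_trans wy1.
- move=> y ly; have [yr|ry] := leP (enorm y) rho.
    by apply: cP; rewrite inE.
  rewrite (le_trans wc)// /antisym.
  have ur : u y < - w y1 by apply: rP; rewrite (le_lt_trans _ ry)// /rho le_max lexx.
  by move: ur (u0 (refl e l y)); rewrite /antisym; lra.
Qed.

End decay_at_infinity.

(** * A priori bounds on negative minima *)

Lemma cancel_common_factor {R : realType} (c T X2 Xd C G : R) :
  0 < c -> 0 < T -> 0 < X2 -> 0 < Xd ->
  c / (T * X2) <= C * (G / (Xd * X2)) -> Xd <= C * G * T / c.
Proof.
move=> c0 T0 X0 Xd0; rewrite mulrA ler_pdivlMr ?mulr_gt0// mulrAC.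
rewrite ler_pdivrMr ?mulr_gt0// [leRHS]mulrA [c * _]mulrA ler_pM2r//.
by rewrite ler_pdivlMr// mulrC.
Qed.

Lemma sum_mul_le_double {R : realType} (a b X A : R) : a <= b -> 0 <= X ->
  b * X <= A -> (a + b) * X <= 2 * A.
Proof.
move=> ab X0 bX; rewrite mulrDl [2 * A]mulrDl mul1r lerD//.
by rewrite (le_trans _ bX)// ler_wpM2r.
Qed.

Section negative_minima.
Context {R : realType} {N : nat} (alpha : R) (f : R -> R) (u : 'rV[R]_N -> R).
Hypothesis N0 : (0 < N)%N.
Hypothesis alpha0 : 0 < alpha.
Hypothesis cu : continuous u.
Hypothesis solu : forall x, fracLap_defined alpha u x /\ fracLap alpha u x = f (u x).
Hypothesis u0 : forall x, 0 < u x.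

Let c : R := (4 `^ (N%:R + 2 * alpha) * N%:R ^+ N)^-1.
Let c0 : 0 < c.
Proof. by rewrite invr_gt0 mulr_gt0 ?powR_gt0 ?exprn_gt0 ?ltr0n. Qed.

(** [fracLap_narrow] together with the equation, divided by
u x - u (sigma x) > 0. *)
Lemma negative_minimum_quotient e l x : dot e e = 1 -> negative_minimum u e l x ->
  c / (dot x e - l) `^ (2 * alpha) <=
  (f (u x) - f (u (refl e l x))) / (u x - u (refl e l x)).
Proof.
move=> e1 [lx wx wmin]; have [dx fx] := solu x.
have [dsx fsx] := solu (refl e l x).
have := fracLap_narrow alpha0 cu e1 N0 lx dx dsx wx wmin.
have ux : 0 < u x - u (refl e l x) by rewrite subr_gt0 -subr_lt0.
rewrite fx fsx => h; rewrite ler_pdivlMr//.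
rewrite -lerN2 opprB (le_trans h)// -mulrN opprB -mulrA mulrC.
exact: lexx.
Qed.

Hypothesis umax : exists x0, forall x, u x <= u x0.

(** Narrow region principle: the quotient is at most a Lipschitz constant of [f]
on the range of [u], so it cannot be of order d^(-2 alpha) with [d] small. *)
Lemma negative_minimum_far :
  [locally [lipschitz f s | s in [set s : R | 0 <= s]]] ->
  exists2 d, 0 < d & forall e l x, dot e e = 1 -> negative_minimum u e l x ->
    d <= dot x e - l.
Proof.
move=> lf; have [x0 x0P] := umax.
have [L L0 LP] := lipschitz_segment (u x0) lf.
have a2 : 0 < 2 * alpha by rewrite mulr_gt0.
pose d := (c / L) `^ (2 * alpha)^-1.
have dE : d `^ (2 * alpha) = c / L.
  rewrite /d -powRrM mulVf ?gt_eqF// powRr1//.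
  by rewrite divr_ge0 ?ltW.
exists d; first by rewrite powR_gt0 ?divr_gt0.
move=> e l x e1 nm; have := negative_minimum_quotient e1 nm.
have [lx wx _] := nm.
have ux : 0 < u x - u (refl e l x) by rewrite subr_gt0 -subr_lt0.
have dl0 : 0 < dot x e - l by rewrite subr_gt0.
move=> quot; have qL : (f (u x) - f (u (refl e l x))) / (u x - u (refl e l x)) <= L.
  rewrite ler_pdivrMr// (le_trans (ler_norm _))//.
  rewrite -[u x - _ in leRHS](gtr0_norm ux) LP//; apply/andP; split => //.
  - exact: ltW.
  - exact: ltW.
have {qL}quot := le_trans quot qL.
move: quot; rewrite ler_pdivrMr ?powR_gt0// mulrC -ler_pdivrMr// -dE.
apply: contraTT; rewrite -!ltNge => dd.
apply: gt0_ltr_powR => //; rewrite nnegrE ?(ltW dl0)//.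
exact: powR_ge0.
Qed.

(** Decay at infinity: for |x| > Lam the distance to the hyperplane is at most
2 |x|, and the quotient is both at least of order |x|^(-2 alpha) and at most of
order |x|^(-m gamma), where m gamma > 2 alpha. *)
Lemma negative_minimum_bounded (s0 gamma C m Lam : R) :
  0 < s0 -> 0 < gamma -> 0 < C ->
  (forall a b : R, 0 < a -> a < b -> b < s0 ->
      (f b - f a) / (b - a) <= C * (a + b) `^ gamma) ->
  u x @[x --> at_infinity] --> (0 : R) ->
  2 * alpha / gamma < m ->
  u =O_at_infinity (fun x => 1 / enorm x `^ m) ->
  exists2 r, 0 < r & forall e l x, dot e e = 1 -> - Lam <= l ->
    negative_minimum u e l x -> enorm x <= r.
Proof.
move=> s00 gamma0 C0 fC ulim am Ou.
have m0 : 0 < m by rewrite (lt_trans _ am)// divr_gt0// mulr_gt0.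
have [A [r1 [A0 r10 uA]]] : exists A r1, [/\ 0 < A, 0 < r1 &
    forall x, r1 < enorm x -> u x <= A / enorm x `^ m].
  move: Ou => /eqOP Ou; near (pinfty_nbhs R) => A.
  have A0 : 0 < A by near: A; exact: nbhs_pinfty_gt.
  have [r1 r10 r1P] : exists2 r, 0 < r & forall x, r < enorm x ->
      `|u x| <= A * `|1 / enorm x `^ m|.
    by apply: at_infinityP; near: A.
  exists A, r1; split => // x /r1P; rewrite gtr0_norm// => h.
  by rewrite (le_trans h)// mul1r ger0_norm// invr_ge0 powR_ge0.
have [r2 r20 us0] := small_at_infinity ulim s00.
pose del := m * gamma - 2 * alpha.
have del0 : 0 < del by rewrite subr_gt0 -ltr_pdivrMr.
pose B := C * (2 * A) `^ gamma * 2 `^ (2 * alpha) / c.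
have B0 : 0 < B by rewrite /B divr_gt0 ?mulr_gt0 ?powR_gt0 ?mulr_gt0.
pose r3 := B `^ del^-1.
pose r := Num.max (Num.max r1 r2) (Num.max r3 Lam).
exists r; first by rewrite /r !lt_max r10.
move=> e l x e1 Ll nm; rewrite leNgt; apply/negP => rx.
have [xr1 xr2 xr3 xL] : [/\ r1 < enorm x, r2 < enorm x, r3 < enorm x & Lam < enorm x].
  by move: rx; rewrite /r !gt_max => /andP[/andP[-> ->] /andP[-> ->]].
have [lx wx _] := nm.
have ux : u (refl e l x) < u x by rewrite -subr_lt0.
have x0 : 0 < enorm x by exact: lt_trans xr1.
have := negative_minimum_quotient e1 nm.
have := fC _ _ (u0 _) ux (us0 _ xr2).
move=> h1 h2; have := le_trans h2 h1.
have h3 : (u (refl e l x) + u x) `^ gamma <= (2 * A) `^ gamma / enorm x `^ (m * gamma).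
  have X0 : 0 < enorm x `^ m by rewrite powR_gt0.
  rewrite powRrM ler_pdivlMr ?powR_gt0// -powRM ?addr_ge0 ?(ltW (u0 _)) ?powR_ge0//.
  apply: ge0_ler_powR; rewrite ?nnegrE ?mulr_ge0 ?addr_ge0 ?(ltW (u0 _)) ?(ltW A0) ?(ltW gamma0) ?(ltW X0)//.
  have := uA _ xr1; rewrite ler_pdivlMr//; apply: sum_mul_le_double; exact: ltW.
have h4 : c / (2 `^ (2 * alpha) * enorm x `^ (2 * alpha)) <= c / (dot x e - l) `^ (2 * alpha).
  rewrite ler_pM2l// lef_pV2 ?posrE ?mulr_gt0 ?powR_gt0 ?subr_gt0//.
  rewrite -powRM ?(ltW x0)//; apply: ge0_ler_powR; rewrite ?nnegrE ?mulr_ge0 ?(ltW alpha0) ?(ltW x0)//.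
    by rewrite subr_ge0 ltW.
  have := dot_unit_le x e1; lra.
move=> h5.
have : enorm x `^ del <= B.
  have mE : enorm x `^ (m * gamma) = enorm x `^ del * enorm x `^ (2 * alpha).
    rewrite -powRD ?subrK//; by apply/implyP => _; rewrite gt_eqF.
  have h6 := le_trans h4 (le_trans h5 (ler_wpM2l (ltW C0) h3)).
  by rewrite mE in h6; apply: cancel_common_factor h6; rewrite ?powR_gt0.
rewrite leNgt => /negP; apply.
have -> : B = r3 `^ del.
  by rewrite /r3 -powRrM mulVf ?gt_eqF// powRr1// ltW.
by apply: gt0_ltr_powR => //; rewrite nnegrE ?powR_ge0// ltW.
Unshelve. all: by end_near. Qed.

End negative_minima.

(** * Moving the planes *)

Section moving_planes.
Context {R : realType} {N : nat} (alpha : R) (f : R -> R) (u : 'rV[R]_N -> R).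
Hypothesis N0 : (0 < N)%N.
Hypothesis alpha0 : 0 < alpha.
Hypothesis cu : continuous u.
Hypothesis solu : forall x, fracLap_defined alpha u x /\ fracLap alpha u x = f (u x).
Hypothesis u0 : forall x, 0 < u x.
Hypothesis ulim : u x @[x --> at_infinity] --> (0 : R).
Hypothesis nm_far : exists2 d, 0 < d & forall e l x, dot e e = 1 ->
  negative_minimum u e l x -> d <= dot x e - l.
Hypothesis nm_bounded : forall Lam, exists2 r, 0 < r & forall e l x,
  dot e e = 1 -> - Lam <= l -> negative_minimum u e l x -> enorm x <= r.

Section direction.
Context (e : 'rV[R]_N).
Hypothesis e1 : dot e e = 1.
Notation w l := (antisym u e l).
Notation sigma l := (refl e l).

Definition symmetric_about (l : R) := forall y, u (sigma l y) = u y.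
Definition nonneg_side (l : R) := forall y, l <= dot y e -> 0 <= w l y.

(** Strong maximum principle: at an interior zero of w both values of [f] agree,
which [fracLap_strict] forbids unless w vanishes identically. *)
Lemma antisym_pos_or_symmetric l : nonneg_side l ->
  (forall x, l < dot x e -> 0 < w l x) \/ symmetric_about l.
Proof.
move=> wl; have [[x [lx wx]]|nz] := pselect (exists x, l < dot x e /\ w l x = 0);
    last first.
  left=> x lx; rewrite lt_neqAle wl ?ltW// andbT eq_sym.
  by apply/negP => /eqP wx; apply: nz; exists x.
right; have wl0 y : l < dot y e -> w l y = 0.
  move=> ly; apply/eqP; rewrite eq_le wl ?(ltW ly)// andbT leNgt.
  apply/negP => wy; have [dx fx] := solu x; have [dsx fsx] := solu (sigma l x).
  have := fracLap_strict alpha0 cu e1 N0 lx ly dx dsx wx wl wy.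
  by rewrite fx fsx; move/eqP: wx; rewrite /antisym subr_eq0 => /eqP ->; rewrite ltxx.
move=> y; apply/eqP; rewrite -subr_eq0; apply/eqP.
have [yl|ly|yl] := ltgtP (dot y e) l; last exact: antisym_hyperplane.
  have := wl0 (sigma l y); rewrite dot_refl// antisym_refl//.
  move=> h; apply/eqP; rewrite -oppr_eq0; apply/eqP; apply: h.
  by rewrite mulr_natl mulr2n -addrA ltrDl subr_gt0.
exact: wl0.
Qed.

(** The composition of the two reflections is a translation, so [u] would be
periodic and could not tend to 0. *)
Lemma not_symmetric_twice l1 l2 : l1 < l2 ->
  symmetric_about l1 -> symmetric_about l2 -> False.
Proof.
move=> l12 s1 s2; pose t := 2 * (l2 - l1).
have t0 : 0 < t by rewrite mulr_gt0// subr_gt0.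
have per y : u (y + t *: e) = u y.
  have -> : y + t *: e = sigma l2 (sigma l1 y).
    rewrite {1}/refl dot_refl// /refl -addrA -opprD -scalerDl -scaleNr.
    by congr (_ + _ *: _); rewrite /t; ring.
  by rewrite s2 s1.
have perk k : u ((k%:R * t) *: e) = u 0.
  elim: k => [|k IH]; first by rewrite mul0r scale0r.
  by rewrite -natr1 mulrDl mul1r scalerDl per.
have [r r0 rP] := small_at_infinity ulim (u0 0).
pose k := (Num.truncn (r / t)).+1.
have : u ((k%:R * t) *: e) < u 0.
  apply: rP; rewrite enormZ enorm_unit// mulr1.
  rewrite ger0_norm; last by rewrite mulr_ge0// ltW.
  by rewrite -ltr_pdivrMr// truncnS_gt.
by rewrite perk ltxx.
Qed.

Lemma antisym_joint_continuous x l : {for (x, l), continuous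
  (fun z : 'rV[R]_N * R => w z.2 z.1)}.
Proof.
have c1 : (fun z : 'rV[R]_N * R => z.1) y @[y --> nbhs (x, l)] --> x by exact: cvg_fst.
have c2 : (fun z : 'rV[R]_N * R => z.2) y @[y --> nbhs (x, l)] --> l by exact: cvg_snd.
have cdot : (dot y.1 e) @[y --> nbhs (x, l)] --> dot x e.
  exact: (cvg_comp _ _ c1 (@continuous_dotl R N e x)).
have cs : (refl e y.2 y.1) @[y --> nbhs (x, l)] --> refl e l x.
  apply: (@cvgB R _ _ (nbhs (x, l))) => //.
  apply: (@cvgZr_tmp R _ _ (nbhs (x, l))); apply: (@cvgMl_tmp R _ (nbhs (x, l))).
  exact: (@cvgB R _ _ (nbhs (x, l))).
apply: (@cvgB R _ _ (nbhs (x, l))).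
  exact: (cvg_comp _ _ cs (@cu _)).
exact: (cvg_comp _ _ c1 (@cu x)).
Qed.

(** For l' near [l], a negative minimum would lie in a fixed compact part of the
open half-space, where w is positive and remains so under small changes of
[l]. *)
Lemma nonneg_side_open l : (forall x, l < dot x e -> 0 < w l x) ->
  exists2 eps, 0 < eps & forall l', `|l' - l| < eps -> nonneg_side l'.
Proof.
move=> wl; have [d d0 dP] := nm_far.
have [r r0 rP] := nm_bounded (1 - l).
pose K := [set x : 'rV[R]_N | enorm x <= r] `&` [set x | l + d / 2 <= dot x e].
have cK : compact K.
  apply: (subclosed_compact _ (@closed_ball_compact R N r)); last by move=> x [].
  apply: closedI; first exact: compact_closed (closed_ball_compact (r := r)).
  rewrite (_ : [set _ | _] = (fun x => dot x e) @^-1` [set t | l + d / 2 <= t])//.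
  by apply: closed_comp; [move=> x _; exact: continuous_dotl|exact: closed_ge].
have : \forall l' \near l, K `<=` [set x | 0 < w l' x].
  have ncK := (proj1 (compact_near_coveringP K)) cK.
  apply: (ncK _ (nbhs l) (fun l' x => 0 < w l' x)) => x [_ /= lx].
  apply: (@cvgr_gt R _ (nbhs (x, l)) _ _ (w l x)); first exact: antisym_joint_continuous.
  by apply: wl; rewrite (lt_le_trans _ lx)// ltrDl divr_gt0.
move=> /nbhs_ballP[eps /= eps0 epsP].
exists (Num.min eps (Num.min (d / 2) 1)).
  by rewrite !lt_min eps0 ltr01 divr_gt0.
move=> l'; rewrite !lt_min => /andP[l'eps /andP[l'd l'1]] y ly.
rewrite leNgt; apply/negP => wy.
have [x nm] := exists_negative_minimum cu u0 ulim ly wy.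
have := nm; case=> _ wx _.
have Kx : K x.
  split => /=; first by apply: (rP e l') => //; move: l'1; rewrite ltr_norml; lra.
  have := dP _ _ _ e1 nm; move: l'd; rewrite ltr_norml; lra.
have := epsP l' _ x Kx; rewrite /ball/= distrC => /(_ l'eps) /=.
by rewrite ltNge (ltW wx).
Qed.

(** The stopping position is the supremum of the positions at which w takes a
negative value; such positions exist because [u] is small far away. *)
Lemma moving_planes_stop : exists l0, symmetric_about l0 /\
  forall l x, l0 < l -> l < dot x e -> u x < u (sigma l x).
Proof.
pose bad := [set l | exists2 y, l <= dot y e & w l y < 0].
have [r r0 rP] := nm_bounded 0.
have bad_le l : bad l -> l <= r.
  move=> [y ly wy]; have [x nm] := exists_negative_minimum cu u0 ulim ly wy.
  have [l0|l0] := leP l 0; first by rewrite (le_trans l0)// ltW.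
  have [lx _ _] := nm; rewrite (le_trans (ltW lx))// (le_trans (dot_unit_le _ e1))//.
  by apply: (rP e l) => //; rewrite oppr0 ltW.
have good_nonneg l : ~ bad l -> nonneg_side l.
  move=> nb y ly; rewrite leNgt; apply/negP => wy; apply: nb; by exists y.
have [rho rho0 rhoP] := small_at_infinity ulim (u0 0).
have bad_ex : bad (- rho).
  exists 0; first by rewrite dot0l oppr_le0 ltW.
  rewrite /antisym subr_lt0; apply: rhoP.
  rewrite /refl dot0l !sub0r opprK enormN enormZ enorm_unit// mulr1.
  by rewrite gtr0_norm ?mulr_gt0// ltr_pMl// ltr1n.
have bad_sup : has_sup bad.
  by split; [exists (- rho)|exists r => l /bad_le].
pose l0 := sup bad.
have good l : l0 < l -> nonneg_side l.
  move=> l0l; apply: good_nonneg => bl.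
  by have := sup_upper_bound bad_sup bl; rewrite leNgt l0l.
have good0 : nonneg_side l0.
  apply: good_nonneg => -[y ly wy].
  have {}ly : l0 < dot y e.
    move: ly; rewrite le_eqVlt => /predU1P[ly|//].
    by move: wy; rewrite antisym_hyperplane ?ltxx.
  have nw : \forall l \near l0, w l y < 0.
    apply: (@cvgr_lt R _ (nbhs l0) _ _ (w l0 y)) => //.
    have cs : (refl e l y) @[l --> nbhs l0] --> refl e l0 y.
      apply: (@cvgB R _ _ (nbhs l0)); first exact: cvg_cst.
      apply: (@cvgZr_tmp R _ _ (nbhs l0)); apply: (@cvgMl_tmp R _ (nbhs l0)).
      by apply: (@cvgB R _ _ (nbhs l0)); [exact: cvg_cst|exact: cvg_id].
    apply: (@cvgB R _ _ (nbhs l0)); last exact: cvg_cst.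
    exact: (cvg_comp _ _ cs (@cu _)).
  have /nbhs_ballP[eps /= eps0 epsP] := nw.
  pose l := Num.min (l0 + eps / 2) (dot y e).
  have l0l : l0 < l by rewrite /l lt_min ltrDl divr_gt0.
  have : 0 <= w l y by apply: good => //; rewrite /l ge_min lexx orbT.
  rewrite leNgt => /negP; apply; apply: epsP.
  rewrite /ball/= distrC gtr0_norm ?subr_gt0// ltrBlDl /l.
  by rewrite gt_min ltrD2l gtr_pMr// invf_lt1// ltr1n.
have sym0 : symmetric_about l0.
  have [pos|//] := antisym_pos_or_symmetric good0.
  have [eps eps0 epsP] := nonneg_side_open pos.
  have [l bl ll] := sup_adherent eps0 bad_sup.
  have [y ly wy] := bl.
  have := epsP l _ y ly; rewrite leNgt wy => near_l0.
  suff : false by [].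
  apply: near_l0; rewrite ltr_distl.
  by move: ll (sup_upper_bound bad_sup bl); rewrite -/l0; lra.
exists l0; split => // l x l0l lx.
have [pos|sl] := antisym_pos_or_symmetric (good _ l0l).
  by have := pos x lx; rewrite /antisym subr_gt0.
by have := not_symmetric_twice l0l sym0 sl.
Qed.

End direction.

(** A maximum point beyond the stopping hyperplane would contradict the strict
decrease there, and one before it is reflected to a maximum point beyond it. *)
Lemma symmetric_at_maximum x0 : (forall x, u x <= u x0) ->
  forall e, dot e e = 1 -> symmetric_about e (dot x0 e) /\
  forall l x, dot x0 e < l -> l < dot x e -> u x < u (refl e l x).
Proof.
move=> x0max e e1; have [l0 [sym dec]] := moving_planes_stop e1.
suff -> : dot x0 e = l0 by [].
have above x1 : (forall x, u x <= u x1) -> dot x1 e <= l0.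
  move=> x1max; rewrite leNgt; apply/negP => l0x.
  have : u x1 < u (refl e ((l0 + dot x1 e) / 2) x1) by apply: dec; lra.
  by rewrite ltNge x1max.
apply/eqP; rewrite eq_le above//=.
have := above (refl e l0 x0); rewrite dot_refl// => H.
have : 2 * l0 - dot x0 e <= l0 by apply: H => x; rewrite sym.
lra.
Qed.

End moving_planes.

(** * Radial symmetry *)

Section radial.
Context {R : realType} {N : nat} (u : 'rV[R]_N.+1 -> R) (x0 : 'rV[R]_N.+1).
Hypothesis sym : forall e, dot e e = 1 -> symmetric_about u e (dot x0 e).
Hypothesis dec : forall e, dot e e = 1 ->
  forall l x, dot x0 e < l -> l < dot x e -> u x < u (refl e l x).

Let e0 : 'rV[R]_N.+1 := delta_mx ord0 ord0.

Let e01 : dot e0 e0 = 1.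
Proof.
rewrite /dot (bigD1 ord0)//= big1 ?addr0 => [|i i0].
  by rewrite !mxE eqxx mulr1.
by rewrite !mxE (negbTE i0) andbF mulr0.
Qed.

(** For a <> b of equal norm, the reflection in the direction of a - b exchanges
them. *)
Lemma reflection_swaps (a b : 'rV[R]_N.+1) : enorm a = enorm b ->
  u (x0 + a) = u (x0 + b).
Proof.
move=> ab; have [->//|nab] := eqVneq a b.
have d0 : 0 < enorm (a - b) by rewrite enorm_gt0// subr_eq0.
pose e := (enorm (a - b))^-1 *: (a - b).
have e1 : dot e e = 1.
  rewrite /e dotZl dotZr -sqr_enorm expr2 mulrA.
  by move: (enorm (a - b)) d0 => t t0; field; rewrite gt_eqF.
rewrite -(sym e1 (x0 + b)); congr u.
have be : 2 * dot b e = - enorm (a - b).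
  have dd : enorm (a - b) * enorm (a - b) = - 2 * dot b (a - b).
    rewrite -expr2 sqr_enorm !dotE -!sqr_enorm ab (dotC b a); ring.
  have {dd} -> : dot b e = (enorm (a - b))^-1 * (- (enorm (a - b) * enorm (a - b)) / 2).
    by rewrite /e dotZr dd; congr (_ * _); field.
  by move: (enorm (a - b)) d0 => t t0; field; rewrite gt_eqF.
rewrite /refl dotDl [dot x0 e + _]addrC addrK be /e scaleNr opprK scalerA.
by rewrite divff ?gt_eqF// scale1r -addrA [b + _]addrC subrK.
Qed.

Lemma radially_symmetric_decreasing_of_reflections :
  radially_symmetric_decreasing u x0.
Proof.
exists (fun r => u (x0 + r *: e0)); split => [x|r s r0 rs].
  rewrite -[in LHS](subrK x0 x) addrC; apply: reflection_swaps.
  by rewrite enormZ (enorm_unit e01) mulr1 ger0_norm ?enorm_ge0.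
have := dec e01 (l := dot x0 e0 + (r + s) / 2) (x := x0 + s *: e0).
rewrite !dotE e01 mulr1 ltrDl ltrD2l => H.
have : u (x0 + s *: e0) < u (refl e0 (dot x0 e0 + (r + s) / 2) (x0 + s *: e0)).
  by apply: H; lra.
rewrite /refl !dotE e01 mulr1 -addrA -scalerBl.
by congr (_ < u (_ + _ *: _)); field.
Qed.

End radial.

Theorem theorem1p2 (R : realType) (N : nat) (alpha : R) (f : R -> R)
    (u : 'rV[R]_N -> R) (s0 gamma C m : R)
    (hN : (2 <= N)%N)
    (halpha0 : 0 < alpha) (halpha1 : alpha < 1)
    (hf : [locally [lipschitz f s | s in [set s : R | 0 <= s]]])
    (hs0 : 0 < s0) (hgamma : 0 < gamma) (hC : 0 < C)
    (hfC : forall a b : R, 0 < a -> a < b -> b < s0 ->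
      (f b - f a) / (b - a) <= C * (a + b) `^ gamma)
    (hu : classical_solution alpha f u)
    (hu0 : forall x, 0 < u x)
    (hulim : u x @[x --> at_infinity] --> (0 : R))
    (hm : Num.max (2 * alpha / gamma) (N%:R / (gamma + 2)) < m)
    (hum : u =O_at_infinity (fun x => 1 / enorm x `^ m)) :
  exists x0 : 'rV[R]_N, radially_symmetric_decreasing u x0.
Proof.
have [cu solu] := hu; have N0 : (0 < N)%N by exact: leq_trans hN.
have am : 2 * alpha / gamma < m by move: hm; rewrite gt_max => /andP[].
have umax := exists_maximum cu hu0 hulim.
have nm_far := negative_minimum_far N0 halpha0 cu solu hu0 umax hf.
have nm_bounded Lam := negative_minimum_bounded N0 halpha0 cu solu
  hu0 Lam hs0 hgamma hC hfC hulim am hum.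
have [x0 x0max] := umax; exists x0.
have sym := symmetric_at_maximum N0 halpha0 cu solu hu0 hulim nm_far nm_bounded x0max.
move: N0 u x0 sym {hN hm hfC hu hu0 hulim hum cu solu umax nm_far nm_bounded x0max}.
case: N => // n _ u x0 sym.
by apply: radially_symmetric_decreasing_of_reflections => e /sym[].
Qed.
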